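(* Let $W[\Gamma]$ be a spherical (i.e. finite) Coxeter group, and let $\Phi[\Gamma]$ denote its root system, with $|\Phi[\Gamma]|=n$. Then there is a split exact sequence $$1 \to \mathbb{Z}^{n} \to VA[\Gamma]/PVA[\Gamma]' \to W[\Gamma] \to 1$$ such that the group $VA[\Gamma]/PVA[\Gamma]'$ is a crystallographic group of dimension $n$ with holonomy group $W[\Gamma]$. Here $VA[\Gamma]$ is the virtual Artin group of $\Gamma$ and $PVA[\Gamma]'$ is the commutator subgroup of the pure virtual Artin group $PVA[\Gamma]$.
   Context: Coxeter data. A Coxeter matrix on a finite set $S$ is a symmetric matrix $(m_{s,t})_{s,t\in S}$ with entries in $\mathbb{N}\cup\{\infty\}$, $m_{s,s}=1$, and $m_{s,t}=m_{t,s}\ge 2$ for $s\ne t$. It is encoded by its Coxeter graph $\Gamma$ (vertex set $S$; edge $\{s,t\}$ iff $m_{s,t}\ge 3$, labelled by $m_{s,t}$ if $m_{s,t}\ge4$). For group elements $x,y$ and $m\ge1$, $\mathrm{Prod}_R(x,y,m)$ denotes the alternating word $\cdots yxy$ of length $m$ (rightmost letter $y$). The Coxeter group $W[\Gamma]$ is generated by $S$ with relations $s^2=1$ for all $s\in S$ and $\mathrm{Prod}_R(t,s,m_{s,t})=\mathrm{Prod}_R(s,t,m_{s,t})$ for $s\neq t$ with $m_{s,t}<\infty$. It is called spherical if it is finite. Virtual Artin group. $VA[\Gamma]$ is the group generated by $\{\sigma_s\mid s\in S\}\sqcup\{\tau_s\mid s\in S\}$ with relations: (1) $\mathrm{Prod}_R(\sigma_t,\sigma_s,m_{s,t})=\mathrm{Prod}_R(\sigma_s,\sigma_t,m_{s,t})$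 for $s\ne t$, $m_{s,t}<\infty$; (2) $\mathrm{Prod}_R(\tau_t,\tau_s,m_{s,t})=\mathrm{Prod}_R(\tau_s,\tau_t,m_{s,t})$ for $s\neq t$, $m_{s,t}<\infty$, and $\tau_s^2=1$ for $s\in S$; (3) $\mathrm{Prod}_R(\tau_s,\tau_t,m_{s,t}-1)\,\sigma_s=\sigma_r\,\mathrm{Prod}_R(\tau_s,\tau_t,m_{s,t}-1)$ for $s\ne t$, $m_{s,t}<\infty$, where $r=s$ if $m_{s,t}$ is even and $r=t$ if $m_{s,t}$ is odd. The pure virtual Artin group $PVA[\Gamma]$ is the kernel of the surjection $\pi_P: VA[\Gamma]\to W[\Gamma]$, $\pi_P(\sigma_s)=\pi_P(\tau_s)=s$. Root system. Let $V$ be the real vector space with basis $\{\alpha_s\mid s\in S\}$ and symmetric bilinear form $\langle\alpha_s,\alpha_t\rangle=-2\cos(\pi/m_{s,t})$ if $m_{s,t}<\infty$ and $-2$ if $m_{s,t}=\infty$. The Tits representation $\rho: W[\Gamma]\to \mathrm{GL}(V)$ is $\rho(s)(v)=v-\langle v,\alpha_s\rangle\alpha_s$. The root system is $\Phi[\Gamma]=\{\rho(w)(\alpha_s)\mid s\in S, w\in W[\Gamma]\}$; it is finite iff $W[\Gamma]$ is finite. Crystallographic groups. A crystallographic group of dimension $n$ is a discrete subgroup $G$ of $\mathbb{R}^n\rtimes \mathrm{O}(n,\mathbb{R})$ that is uniform (compact quotient); an abstract group is called crystallographic of dimension $n$ if it is isomorphic to such a group. Equivalently (well-known characterisation), there are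 a finite group $H$ and a short exact sequence $0\to\mathbb{Z}^n\to G\xrightarrow{\eta}H\to1$ such that the integral representation $\Theta:H\to\mathrm{GL}(n,\mathbb{Z})$, $\Theta(h)(x)=zxz^{-1}$ (for $x\in\mathbb{Z}^n$, $z\in G$ with $\eta(z)=h$), is faithful; $H$ is then called the holonomy group of $G$ and $n$ its dimension. *)

(* Defs.v *)
From HB Require Import structures.
From mathcomp Require Import all_boot all_order all_algebra.
From mathcomp Require Import generic_quotient.
From mathcomp Require Import all_classical all_reals all_analysis.
From mathcomp Require Import ring lra.
Import Order.TTheory GRing.Theory Num.Theory.
Import numFieldNormedType.Exports.

Set Implicit Arguments.
Unset Strict Implicit.
Unset Printing Implicit Defensive.

Local Open Scope classical_set_scope.
Local Open Scope quotient_scope.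
Local Open Scope group_scope.

(* [GRing.Theory] shadows the group-theoretic [monoid_morphism]. *)
Notation group_morphism := monoid.monoid_morphism.

HB.mixin Record isConjClosed (G : groupType) (N : {pred G}) := {
  gpred_conj : forall x y : G, x \in N -> x ^ y \in N
}.

#[short(type="normalClosed")]
HB.structure Definition NormalClosed (G : groupType) :=
  {N of isConjClosed G N & GroupClosed G N}.

Section Cosets.
Variables (G : groupType) (H : groupClosed G).

Definition coset_rel : rel G := fun x y => x^-1 * y \in H.

Lemma coset_rel_equiv : equiv_class_of coset_rel.
Proof.
split=> [x|x y|y x z]; rewrite /coset_rel.
- by rewrite mulVg gpred1.
- by rewrite -gpredV invgM invgK.
- move=> xy yz; have -> : x^-1 * z = (x^-1 * y) * (y^-1 * z).
    by rewrite -mulgA mulVKg.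
  exact: gpredM.
Qed.

Canonical coset_equiv := EquivRelPack coset_rel_equiv.

(* the space G / H of left cosets xH *)
Definition cosets := {eq_quot coset_rel}.
HB.instance Definition _ := Choice.on cosets.
HB.instance Definition _ := EqQuotient.on cosets.

Lemma cosetP (x y : G) : reflect (\pi_cosets%qT x = \pi_cosets%qT y)
  (x^-1 * y \in H).
Proof. exact: (@eqquotP _ coset_rel cosets x y). Qed.
End Cosets.

Section QuotientGroup.
Variables (G : groupType) (N : normalClosed G).

Definition quotient_group := cosets N.
Local Notation Q := quotient_group.
HB.instance Definition _ := Choice.on Q.
HB.instance Definition _ := EqQuotient.on Q.

Definition quot_pi (x : G) : Q := \pi_Q%qT x.
Definition quot_mul (a b : Q) : Q := quot_pi (repr a * repr b).
Definition quot_inv (a : Q) : Q := quot_pi (repr a)^-1.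

Lemma quot_piP x y : reflect (quot_pi x = quot_pi y) (x^-1 * y \in N).
Proof. exact: cosetP. Qed.

Lemma quot_piK (a : Q) : quot_pi (repr a) = a.
Proof. exact: reprK. Qed.

Lemma quot_repr x : x^-1 * repr (quot_pi x) \in N.
Proof. by apply/quot_piP; rewrite quot_piK. Qed.

Lemma quot_mulE x y : quot_mul (quot_pi x) (quot_pi y) = quot_pi (x * y).
Proof.
apply/esym/quot_piP; set x' := repr _; set y' := repr _.
have -> : (x * y)^-1 * (x' * y') = (x^-1 * x') ^ y * (y^-1 * y').
  by rewrite /conjg invgM !mulgA mulgK.
by apply: gpredM; [apply: gpred_conj|]; exact: quot_repr.
Qed.

Lemma quot_invE x : quot_inv (quot_pi x) = quot_pi x^-1.
Proof.
apply/quot_piP; set x' := repr _; rewrite invgK.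
have -> : x' * x^-1 = (x^-1 * x') ^ x^-1.
  by rewrite /conjg invgK !mulgA mulgV mul1g.
by apply: gpred_conj; exact: quot_repr.
Qed.

Lemma quot_ind (P : Q -> Prop) : (forall x, P (quot_pi x)) -> forall a, P a.
Proof. by move=> PX a; rewrite -[a]quot_piK. Qed.

Fact quot_mulA : associative quot_mul.
Proof.
elim/quot_ind=> x; elim/quot_ind=> y; elim/quot_ind=> z.
by rewrite !quot_mulE mulgA.
Qed.
Fact quot_mul1g : left_id (quot_pi 1) quot_mul.
Proof. by elim/quot_ind=> x; rewrite quot_mulE mul1g. Qed.
Fact quot_mulg1 : right_id (quot_pi 1) quot_mul.
Proof. by elim/quot_ind=> x; rewrite quot_mulE mulg1. Qed.
Fact quot_mulVg : left_inverse (quot_pi 1) quot_inv quot_mul.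
Proof. by elim/quot_ind=> x; rewrite quot_invE quot_mulE mulVg. Qed.
Fact quot_mulgV : right_inverse (quot_pi 1) quot_inv quot_mul.
Proof. by elim/quot_ind=> x; rewrite quot_invE quot_mulE mulgV. Qed.

HB.instance Definition _ := isGroup.Build Q
  quot_mulA quot_mul1g quot_mulg1 quot_mulVg quot_mulgV.

Fact quot_pi_monoid_morphism : group_morphism quot_pi.
Proof. by split=> // x y; rewrite -quot_mulE. Qed.
HB.instance Definition _ :=
  isUMagmaMorphism.Build G Q quot_pi quot_pi_monoid_morphism.
End QuotientGroup.

Section Generated.
Variable G : groupType.

Definition generated (A : set G) : {pred G} :=
  [pred x : G | `[< forall H : groupClosed G, (forall a, A a -> a \in H) ->
                    x \in H >]].

Lemma generatedP (A : set G) x :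
  reflect (forall H : groupClosed G, (forall a, A a -> a \in H) -> x \in H)
          (x \in generated A).
Proof. exact: asboolP. Qed.

Lemma mem_generated (A : set G) x : A x -> x \in generated A.
Proof. by move=> Ax; apply/generatedP => H; apply. Qed.

Fact generated_mulg_closed A : mulg_closed (generated A).
Proof.
move=> x y /generatedP xA /generatedP yA; apply/generatedP => H AH.
by rewrite gpredM ?xA ?yA.
Qed.
Fact generated_mem1 A : 1 \in generated A.
Proof. by apply/generatedP => H _; exact: gpred1. Qed.
Fact generated_invg_closed A : invg_closed (generated A).
Proof.
by move=> x /generatedP xA; apply/generatedP => H AH; rewrite gpredV xA.
Qed.
HB.instance Definition _ A :=
  isMulClosed.Build G (generated A) (@generated_mulg_closed A).
HB.instance Definition _ A :=
  isMul1Closed.Build G (generated A) (generated_mem1 A).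
HB.instance Definition _ A :=
  isInvClosed.Build G (generated A) (@generated_invg_closed A).

Section Conj.
Variables (H : groupClosed G) (y : G).
Definition conj_pred : {pred G} := [pred x | x ^ y \in H].
Fact conj_pred_mulg_closed : mulg_closed conj_pred.
Proof. by move=> a b; rewrite !inE conjMg => *; exact: gpredM. Qed.
Fact conj_pred_mem1 : 1 \in conj_pred.
Proof. by rewrite inE conj1g gpred1. Qed.
Fact conj_pred_invg_closed : invg_closed conj_pred.
Proof. by move=> a; rewrite !inE conjVg gpredV. Qed.
HB.instance Definition _ :=
  isMulClosed.Build G conj_pred conj_pred_mulg_closed.
HB.instance Definition _ :=
  isMul1Closed.Build G conj_pred conj_pred_mem1.
HB.instance Definition _ :=
  isInvClosed.Build G conj_pred conj_pred_invg_closed.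
End Conj.

Lemma generated_conj (A : set G) :
  (forall a y, A a -> A (a ^ y)) ->
  forall x y, x \in generated A -> x ^ y \in generated A.
Proof.
move=> Aconj x y /generatedP xA; apply/generatedP => H AH.
have /xA : forall a, A a -> a \in conj_pred H y.
  by move=> a Aa; rewrite inE; apply/AH/Aconj.
by rewrite inE.
Qed.

Definition normal_closure (A : set G) : {pred G} :=
  generated [set x | exists2 a, A a & exists y, x = a ^ y].

Fact normal_closure_conj A x y :
  x \in normal_closure A -> x ^ y \in normal_closure A.
Proof.
apply: generated_conj => _ z [a Aa [w ->]].
by exists a => //; exists (w * z); rewrite conjgM.
Qed.
HB.instance Definition _ A := GroupClosed.on (normal_closure A).
HB.instance Definition _ A :=
  isConjClosed.Build G (normal_closure A) (@normal_closure_conj A).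

Lemma mem_normal_closure (A : set G) a : A a -> a \in normal_closure A.
Proof.
by move=> Aa; apply: mem_generated; exists a => //; exists 1; rewrite conjg1.
Qed.

Section Derived.
Variable N : normalClosed G.
Definition derived : {pred G} :=
  generated [set z | exists x y, [/\ x \in N, y \in N & z = [~ x, y]]].
Fact derived_conj x y : x \in derived -> x ^ y \in derived.
Proof.
apply: generated_conj => _ z [a [b [Na Nb ->]]].
by exists (a ^ z), (b ^ z); rewrite !gpred_conj // conjRg.
Qed.
HB.instance Definition _ := GroupClosed.on derived.
HB.instance Definition _ := isConjClosed.Build G derived derived_conj.
End Derived.
End Generated.

Section Kernel.
Variables (G H : groupType) (f : UMagmaMorphism.type G H).
Definition gker : {pred G} := [pred x | f x == 1].
Fact gker_mulg_closed : mulg_closed gker.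
Proof.
by move=> x y; rewrite !inE gmulfM => /eqP -> /eqP ->; rewrite mulg1.
Qed.
Fact gker_mem1 : 1 \in gker. Proof. by rewrite inE gmulf1. Qed.
Fact gker_invg_closed : invg_closed gker.
Proof. by move=> x; rewrite !inE gmulfV => /eqP ->; rewrite invg1. Qed.
Fact gker_conj x y : x \in gker -> x ^ y \in gker.
Proof. by rewrite !inE gmulfJ => /eqP ->; rewrite conj1g. Qed.
HB.instance Definition _ := isMulClosed.Build G gker gker_mulg_closed.
HB.instance Definition _ := isMul1Closed.Build G gker gker_mem1.
HB.instance Definition _ := isInvClosed.Build G gker gker_invg_closed.
HB.instance Definition _ := isConjClosed.Build G gker gker_conj.
End Kernel.

Section FreeGroup.
Variable X : choiceType.

(* the letter (x, true) stands for x^-1 *)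
Definition word := seq (X * bool).
HB.instance Definition _ := Choice.on word.

Definition inv_letter (a : X * bool) : X * bool := (a.1, ~~ a.2).
Definition inv_word (u : word) : word := rev (map inv_letter u).

Inductive word_equiv : word -> word -> Prop :=
| WordRefl u : word_equiv u u
| WordSym u v : word_equiv u v -> word_equiv v u
| WordTrans v u w : word_equiv u v -> word_equiv v w -> word_equiv u w
| WordCancel u v a : word_equiv (u ++ a :: inv_letter a :: v) (u ++ v).

Definition word_rel : rel word := fun u v => `[< word_equiv u v >].

Lemma word_rel_equiv : equiv_class_of word_rel.
Proof.
split=> [u|u v|v u w].
- by apply/asboolP; exact: WordRefl.
- by apply/asboolP/asboolP => ?; exact: WordSym.
- by move=> /asboolP uv /asboolP vw; apply/asboolP; exact: WordTrans vw.
Qed.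
Canonical word_equiv_rel := EquivRelPack word_rel_equiv.

Definition free_group := {eq_quot word_rel}.
HB.instance Definition _ := Choice.on free_group.
HB.instance Definition _ := EqQuotient.on free_group.

Definition word_class (u : word) : free_group := \pi_free_group%qT u.

Lemma word_classP u v : word_class u = word_class v <-> word_equiv u v.
Proof.
split=> [/(@eqquotP _ word_rel free_group) /asboolP //|uv].
by apply/(@eqquotP _ word_rel free_group)/asboolP.
Qed.

Lemma word_classK (x : free_group) : word_class (repr x) = x.
Proof. exact: reprK. Qed.

Lemma word_equiv_cat p q u v :
  word_equiv u v -> word_equiv (p ++ u ++ q) (p ++ v ++ q).
Proof.
elim=> [{}u|{}u {}v _|{}v {}u w _ uv _|{}u {}v a]; last 1 first.
- by rewrite -[(u ++ _) ++ q]catA -[(u ++ v) ++ q]catA !(catA p) /=;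
    exact: WordCancel.
- exact: WordRefl.
- exact: WordSym.
- exact: WordTrans.
Qed.

Lemma inv_letterK : involutive inv_letter.
Proof. by case=> x b; rewrite /inv_letter /= negbK. Qed.

Lemma word_equiv_inv u v : word_equiv u v ->
  word_equiv (inv_word u) (inv_word v).
Proof.
elim=> [{}u|{}u {}v _|{}v {}u w _ uv _|{}u {}v a]; last 1 first.
- rewrite /inv_word !map_cat /= !rev_cat !rev_cons -!cats1 -!catA /= inv_letterK.
  by rewrite -[X in word_equiv (_ ++ X)]/(a :: inv_letter a :: _);
    exact: WordCancel.
- exact: WordRefl.
- exact: WordSym.
- exact: WordTrans.
Qed.

Lemma word_catV u : word_equiv (u ++ inv_word u) [::].
Proof.
elim: u => [|a u IHu]; first exact: WordRefl.
rewrite /inv_word /= rev_cons -cats1.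
have := word_equiv_cat [:: a] [:: inv_letter a] IHu.
rewrite -catA /= => /WordTrans; apply.
exact: (WordCancel [::] [::] a).
Qed.

Lemma inv_wordK : involutive inv_word.
Proof.
by move=> u; rewrite /inv_word map_rev revK mapK //; exact: inv_letterK.
Qed.

Definition free_mul (x y : free_group) : free_group :=
  word_class (repr x ++ repr y).
Definition free_inv (x : free_group) : free_group :=
  word_class (inv_word (repr x)).

Lemma repr_word u : word_equiv (repr (word_class u)) u.
Proof. by apply/word_classP; rewrite word_classK. Qed.

Lemma free_mulE u v : free_mul (word_class u) (word_class v) = word_class (u ++ v).
Proof.
apply/word_classP; apply: (@WordTrans (u ++ repr (word_class v))).
  exact: (word_equiv_cat [::] _ (repr_word u)).
by have := word_equiv_cat u [::] (repr_word v); rewrite !cats0.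
Qed.

Lemma free_invE u : free_inv (word_class u) = word_class (inv_word u).
Proof. by apply/word_classP/word_equiv_inv/repr_word. Qed.

Lemma free_ind (P : free_group -> Prop) :
  (forall u, P (word_class u)) -> forall x, P x.
Proof. by move=> PX x; rewrite -[x]word_classK. Qed.

Fact free_mulA : associative free_mul.
Proof.
elim/free_ind=> x; elim/free_ind=> y; elim/free_ind=> z.
by rewrite !free_mulE catA.
Qed.
Fact free_mul1g : left_id (word_class [::]) free_mul.
Proof. by elim/free_ind=> x; rewrite free_mulE. Qed.
Fact free_mulg1 : right_id (word_class [::]) free_mul.
Proof. by elim/free_ind=> x; rewrite free_mulE cats0. Qed.
Fact free_mulgV : right_inverse (word_class [::]) free_inv free_mul.
Proof.
by elim/free_ind=> x; rewrite free_invE free_mulE; apply/word_classP/word_catV.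
Qed.
Fact free_mulVg : left_inverse (word_class [::]) free_inv free_mul.
Proof.
elim/free_ind=> x; rewrite free_invE free_mulE; apply/word_classP.
by have := word_catV (inv_word x); rewrite inv_wordK.
Qed.

HB.instance Definition _ := isGroup.Build free_group
  free_mulA free_mul1g free_mulg1 free_mulVg free_mulgV.

Definition free_gen (x : X) : free_group := word_class [:: (x, false)].

Section Lift.
Variables (G : groupType) (f : X -> G).

Definition eval_letter (a : X * bool) : G := if a.2 then (f a.1)^-1 else f a.1.
Definition eval_word (u : word) : G := \prod_(a <- u) eval_letter a.
Definition free_lift (x : free_group) : G := eval_word (repr x).

Lemma eval_word_equiv u v : word_equiv u v -> eval_word u = eval_word v.
Proof.
elim=> [//|//|{}v {}u w _ -> _ -> //|{}u {}v [x b]].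
rewrite /eval_word !big_cat !big_cons /=; congr (_ * _).
by rewrite mulgA /eval_letter; case: b; rewrite /= ?mulVg ?mulgV mul1g.
Qed.

Lemma free_liftE u : free_lift (word_class u) = eval_word u.
Proof. exact/eval_word_equiv/repr_word. Qed.

Fact free_lift_monoid_morphism : group_morphism free_lift.
Proof.
split; first by rewrite free_liftE /eval_word big_nil.
elim/free_ind=> x; elim/free_ind=> y.
by rewrite [_ * _]free_mulE !free_liftE /eval_word big_cat.
Qed.
HB.instance Definition _ :=
  isUMagmaMorphism.Build free_group G free_lift free_lift_monoid_morphism.

Lemma free_lift_gen x : free_lift (free_gen x) = f x.
Proof. by rewrite free_liftE /eval_word big_seq1. Qed.
End Lift.
End FreeGroup.

Section Presented.
Variables (X : choiceType) (rel : free_group X -> free_group X -> Prop).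

Definition relators : set (free_group X) :=
  [set z | exists u v, rel u v /\ z = u / v].

(* the group < X | u = v for all (u, v) with rel u v > *)
Definition presented_group : groupType := quotient_group (normal_closure relators).

Definition pgen (x : X) : presented_group :=
  quot_pi (normal_closure relators) (free_gen x).

Lemma presented_rel u v : rel u v ->
  quot_pi (normal_closure relators) u = quot_pi (normal_closure relators) v.
Proof.
move=> uv; apply/quot_piP.
have -> : u^-1 * v = (v / u) ^ u by rewrite /conjg mulgVK.
by rewrite gpred_conj // -gpredV invgF mem_normal_closure //; exists u, v.
Qed.

Section Lift.
Variables (G : groupType) (f : X -> G).

(* the morphism extending f, provided that f satisfies the relations *)
Definition plift (a : presented_group) : G := free_lift f (repr a).

Hypothesis f_rel : forall u v, rel u v -> free_lift f u = free_lift f v.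

Lemma plift_pi u : plift (quot_pi (normal_closure relators) u) = free_lift f u.
Proof.
suff sub x : x \in normal_closure relators -> free_lift f x = 1.
  have /sub := quot_repr (normal_closure relators) u.
  rewrite gmulfM gmulfV => uu.
  by rewrite /plift -[RHS]mulg1 -uu mulVKg.
move=> /generatedP /(_ (gker (free_lift f))); rewrite inE => h; apply/eqP/h.
move=> _ [_ [v [w [/f_rel vw ->]]] [y ->]].
by rewrite inE gmulfJ gmulfF /= vw divgg conj1g.
Qed.

Lemma plift_monoid_morphism : group_morphism plift.
Proof.
split; first by have := plift_pi 1; rewrite !gmulf1.
by elim/quot_ind=> x; elim/quot_ind=> y; rewrite -gmulfM /= !plift_pi gmulfM.
Qed.

Lemma plift_gen x : plift (pgen x) = f x.
Proof. by rewrite plift_pi free_lift_gen. Qed.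
End Lift.
End Presented.

Section Alternating.
Variable G : groupType.
Implicit Types x y : G.

(* the alternating product ... y x y of length k, whose rightmost factor is y *)
Fixpoint prodR x y (k : nat) : G :=
  if k is k'.+1 then prodR y x k' * y else 1.

Lemma prodRSl x y k : prodR x y k.+1 = (if odd k then x else y) * prodR x y k.
Proof.
elim: k x y => [|k IHk] x y; first by rewrite /= mul1g mulg1.
by rewrite [LHS]/= -/(prodR y x k.+1) IHk /= -mulgA; case: (odd k).
Qed.

Lemma prodR_involutive x y k : x * x = 1 -> y * y = 1 ->
  prodR x y k * (prodR y x k)^-1 = (if odd k then y * x else x * y) ^+ k.
Proof.
move=> xx yy; have xV : x^-1 = x by rewrite -[LHS]mulg1 -xx mulKg.
have yV : y^-1 = y by rewrite -[LHS]mulg1 -yy mulKg.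
elim: k => [|k IHk]; first by rewrite /= invg1 mulg1.
rewrite !prodRSl invgM -mulgA (mulgA (prodR x y k)) IHk /=.
have expC (a b : G) : a * ((b * a) ^+ k * b) = (a * b) ^+ k.+1.
  elim: k {IHk} => [|k IHk]; first by rewrite expg0 mul1g expg1.
  by rewrite expgS -(mulgA (b * a)) -(mulgA b) IHk [RHS]expgS -mulgA.
by case: (odd k); rewrite /= ?xV ?yV expC.
Qed.

Lemma prodR_braid x y k : x * x = 1 -> y * y = 1 -> (x * y) ^+ k = 1 ->
  prodR x y k = prodR y x k.
Proof.
move=> xx yy xyk; apply/divg1_eq; rewrite prodR_involutive //.
case: (odd k) => //; suff -> : y * x = (x * y)^-1 by rewrite expVgn xyk invg1.
by rewrite invgM -[in LHS](mulg1 x) -[in LHS](mulgV x) !mulgA -(mulgA _ x x) xx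
   mulg1 -[y in LHS](mulg1 y) -(mulgV y) !mulgA yy mul1g.
Qed.
End Alternating.

Lemma prodR_morph (G H : groupType) (f : UMagmaMorphism.type G H) x y k :
  f (prodR x y k) = prodR (f x) (f y) k.
Proof. by elim: k x y => [|k IHk] x y; rewrite /= ?gmulf1 // gmulfM IHk. Qed.

(* [None] stands for the label infinity *)
Record coxeter_matrix (S : finType) := CoxeterMatrix {
  cox_label :> S -> S -> option nat;
  cox_sym : forall s t, cox_label s t = cox_label t s;
  cox_diag : forall s, cox_label s s = Some 1%N;
  cox_offdiag : forall s t k, s != t -> cox_label s t = Some k -> (2 <= k)%N
}.

Section CoxeterGroup.
Variables (S : finType) (m : coxeter_matrix S).

Inductive coxeter_rel : free_group S -> free_group S -> Prop :=
| CoxInvol s : coxeter_rel (free_gen s ^+ 2) 1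
| CoxBraid s t k : s != t -> m s t = Some k ->
    coxeter_rel (prodR (free_gen t) (free_gen s) k)
                (prodR (free_gen s) (free_gen t) k).

Definition coxeter_group : groupType := presented_group coxeter_rel.
Definition cox_gen (s : S) : coxeter_group := pgen coxeter_rel s.

Lemma cox_gen_invol s : cox_gen s * cox_gen s = 1.
Proof. by have /presented_rel := CoxInvol s; rewrite gmulfXn gmulf1. Qed.

Lemma cox_gen_braid s t k : s != t -> m s t = Some k ->
  prodR (cox_gen t) (cox_gen s) k = prodR (cox_gen s) (cox_gen t) k.
Proof.
by move=> st mst; have /presented_rel := CoxBraid st mst; rewrite !prodR_morph.
Qed.
End CoxeterGroup.

Section VirtualArtin.
Variables (S : finType) (m : coxeter_matrix S).

Local Notation F := (free_group (S + S)%type).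
Local Notation sg s := (free_gen (inl s : S + S)%type).
Local Notation tu s := (free_gen (inr s : S + S)%type).

Inductive virtual_artin_rel : F -> F -> Prop :=
| VASigmaBraid s t k : s != t -> m s t = Some k ->
    virtual_artin_rel (prodR (sg t) (sg s) k) (prodR (sg s) (sg t) k)
| VATauBraid s t k : s != t -> m s t = Some k ->
    virtual_artin_rel (prodR (tu t) (tu s) k) (prodR (tu s) (tu t) k)
| VATauInvol s : virtual_artin_rel (tu s ^+ 2) 1
| VAMixed s t k : s != t -> m s t = Some k ->
    virtual_artin_rel (prodR (tu s) (tu t) k.-1 * sg s)
                      (sg (if odd k then t else s) * prodR (tu s) (tu t) k.-1).

Definition virtual_artin_group : groupType := presented_group virtual_artin_rel.
Local Notation VA := virtual_artin_group.

Definition va_sigma (s : S) : VA := pgen virtual_artin_rel (inl s).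
Definition va_tau (s : S) : VA := pgen virtual_artin_rel (inr s).

Definition va_letter (x : S + S) : coxeter_group m :=
  match x with inl s => cox_gen m s | inr s => cox_gen m s end.

Definition pi_P : VA -> coxeter_group m := plift va_letter.

Lemma va_letter_rel u v : virtual_artin_rel u v ->
  free_lift va_letter u = free_lift va_letter v.
Proof.
case=> [s t k st mst|s t k st mst|s|s t k st mst].
- by rewrite !prodR_morph /= !free_lift_gen; exact: cox_gen_braid.
- by rewrite !prodR_morph /= !free_lift_gen; exact: cox_gen_braid.
- by rewrite gmulfXn gmulf1 /= free_lift_gen; exact: cox_gen_invol.
- rewrite !gmulfM !prodR_morph /= !free_lift_gen.
  have := cox_offdiag st mst; case: k mst => // k mst _ /=.
  have := cox_gen_braid st mst; rewrite [X in X = _]/= => ->.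
  by rewrite prodRSl; case: (odd k).
Qed.

Fact pi_P_morphism : group_morphism pi_P.
Proof. exact: plift_monoid_morphism va_letter_rel. Qed.
HB.instance Definition _ :=
  isUMagmaMorphism.Build VA (coxeter_group m) pi_P pi_P_morphism.

Lemma pi_P_sigma s : pi_P (va_sigma s) = cox_gen m s.
Proof. exact: (plift_gen va_letter_rel). Qed.

Lemma pi_P_tau s : pi_P (va_tau s) = cox_gen m s.
Proof. exact: (plift_gen va_letter_rel). Qed.

Definition PVA : normalClosed VA := gker pi_P.

Definition VA_mod_dPVA : groupType := quotient_group (derived PVA).
End VirtualArtin.

Section LinearGroup.
Variables (R : comUnitRingType) (n : nat).
Local Open Scope ring_scope.

Definition linear_group := {A : 'M[R]_n | A \in unitmx}.
HB.instance Definition _ := SubChoice.on linear_group.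
Local Notation GL := linear_group.

Definition gl_one : GL := Sub 1%:M (unitmx1 R n).
Fact gl_mul_subproof (A B : GL) : val A *m val B \in unitmx.
Proof. by rewrite unitmx_mul (valP A) (valP B). Qed.
Definition gl_mul (A B : GL) : GL := Sub (val A *m val B) (gl_mul_subproof A B).
Fact gl_inv_subproof (A : GL) : invmx (val A) \in unitmx.
Proof. by rewrite unitmx_inv (valP A). Qed.
Definition gl_inv (A : GL) : GL := Sub (invmx (val A)) (gl_inv_subproof A).

Fact gl_mulA : associative gl_mul.
Proof. by move=> A B C; apply: val_inj; rewrite /= mulmxA. Qed.
Fact gl_mul1g : left_id gl_one gl_mul.
Proof. by move=> A; apply: val_inj; rewrite /= mul1mx. Qed.
Fact gl_mulg1 : right_id gl_one gl_mul.
Proof. by move=> A; apply: val_inj; rewrite /= mulmx1. Qed.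
Fact gl_mulVg : left_inverse gl_one gl_inv gl_mul.
Proof. by move=> A; apply: val_inj; rewrite /= mulVmx ?(valP A). Qed.
Fact gl_mulgV : right_inverse gl_one gl_inv gl_mul.
Proof. by move=> A; apply: val_inj; rewrite /= mulmxV ?(valP A). Qed.
HB.instance Definition _ := isGroup.Build GL
  gl_mulA gl_mul1g gl_mulg1 gl_mulVg gl_mulgV.
End LinearGroup.

Section RootSystem.
Variables (R : realType) (S : finType) (m : coxeter_matrix S).
Local Open Scope ring_scope.

Local Notation V := 'cV[R]_#|S|.
Implicit Types (u v w : V) (s t : S).

(* coordinates are taken in the basis of simple roots, ordered by [enum_rank] *)
Definition simple_root s : V := delta_mx (enum_rank s) 0.

Definition cox_form_coef s t : R :=
  if m s t is Some k then - (2 * cos (pi / k%:R)) else - 2.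

Definition cox_form v w : R :=
  \sum_s \sum_t cox_form_coef s t * v (enum_rank s) 0 * w (enum_rank t) 0.

Definition reflection s v : V := v - cox_form v (simple_root s) *: simple_root s.

Fact reflection_is_linear s : linear (reflection s).
Proof.
move=> a v w; rewrite /reflection.
have -> : cox_form (a *: v + w) (simple_root s) =
    a * cox_form v (simple_root s) + cox_form w (simple_root s).
  rewrite /cox_form mulr_sumr -big_split; apply: eq_bigr => i _ /=.
  rewrite mulr_sumr -big_split; apply: eq_bigr => j _ /=.
  by rewrite !mxE; ring.
by rewrite scalerBr scalerDl scalerA opprD addrACA.
Qed.
HB.instance Definition _ s :=
  GRing.isLinear.Build R V V *:%R (reflection s) (reflection_is_linear s).

(* the matrix of [reflection s] in the basis of simple roots *)
Definition reflection_mx s : 'M[R]_#|S| :=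
  \matrix_(i, j) reflection s (delta_mx j 0) i 0.

Lemma reflection_mxE s v : reflection_mx s *m v = reflection s v.
Proof.
rewrite [v in RHS]matrix_sum_delta.
under [in RHS]eq_bigr do rewrite big_ord1.
rewrite linear_sum /=; apply/matrixP => i j; rewrite ord1 mxE summxE.
by apply: eq_bigr => k _; rewrite linearZ !mxE mulrC.
Qed.

Lemma cox_form_coefC s t : cox_form_coef s t = cox_form_coef t s.
Proof. by rewrite /cox_form_coef cox_sym. Qed.

Lemma cox_formC v w : cox_form v w = cox_form w v.
Proof.
rewrite /cox_form exchange_big; apply: eq_bigr => s _; apply: eq_bigr => t _.
by rewrite cox_form_coefC -!mulrA [_ * w _ _]mulrC.
Qed.

Lemma cox_form_linearl a v w u :
  cox_form (a *: v + w) u = a * cox_form v u + cox_form w u.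
Proof.
rewrite /cox_form mulr_sumr -big_split; apply: eq_bigr => i _ /=.
rewrite mulr_sumr -big_split; apply: eq_bigr => j _ /=.
by rewrite !mxE; ring.
Qed.

Lemma cox_form0l v : cox_form 0 v = 0.
Proof.
by apply: big1 => s _; apply: big1 => t _; rewrite mxE mulr0 mul0r.
Qed.

Lemma cox_formDl u v w : cox_form (u + v) w = cox_form u w + cox_form v w.
Proof. by rewrite -[u]scale1r cox_form_linearl mul1r scale1r. Qed.

Lemma cox_formZl a v w : cox_form (a *: v) w = a * cox_form v w.
Proof. by rewrite -[a *: v]addr0 cox_form_linearl cox_form0l addr0. Qed.

Lemma cox_form_simple s t :
  cox_form (simple_root s) (simple_root t) = cox_form_coef s t.
Proof.
rewrite /cox_form (bigD1 s) //= [X in _ + X]big1 ?addr0; last first.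
  move=> i is_; apply: big1 => j _.
  by rewrite !mxE !(inj_eq enum_rank_inj) (negPf is_) mulr0 mul0r.
rewrite (bigD1 t) //= [X in _ + X]big1 ?addr0; last first.
  by move=> j jt; rewrite !mxE !(inj_eq enum_rank_inj) (negPf jt) mulr0.
by rewrite !mxE !eqxx /= !mulr1.
Qed.

Lemma cox_form_simple_diag s : cox_form (simple_root s) (simple_root s) = 2.
Proof. by rewrite cox_form_simple /cox_form_coef cox_diag divr1 cospi; ring. Qed.

Lemma reflectionK s : involutive (reflection s).
Proof.
move=> v; rewrite {1}/reflection.
have -> : cox_form (reflection s v) (simple_root s) =
    - cox_form v (simple_root s).
  rewrite /reflection addrC -scaleNr cox_form_linearl cox_form_simple_diag; ring.
by rewrite /reflection scaleNr opprK subrK.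
Qed.

Lemma reflection_mxK s : reflection_mx s *m reflection_mx s = 1%:M.
Proof.
apply/matrixP => i j.
have := congr1 (fun v : V => v i 0) (reflectionK s (delta_mx j 0)).
by rewrite -!reflection_mxE mulmxA -colE !mxE eqxx andbT.
Qed.

Fact reflection_mx_unit s : reflection_mx s \in unitmx.
Proof. by case/mulmx1_unit: (reflection_mxK s). Qed.

Definition reflection_gl s : linear_group R #|S| :=
  Sub (reflection_mx s) (reflection_mx_unit s).

Definition tits_rep : coxeter_group m -> linear_group R #|S| :=
  plift reflection_gl.

Lemma reflection_gl_invol s : (reflection_gl s * reflection_gl s = 1)%g.
Proof. by apply: val_inj; exact: reflection_mxK. Qed.

Section Rank2.
Variables (s t : S) (k : nat).
Hypotheses (st : s != t) (mst : m s t = Some k).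
Let k2 : (2 <= k)%N := cox_offdiag st mst.
Let th : R := pi / k%:R.
Let c := cos th.
Let sn := sin th.
Let a := simple_root s.
Let b := simple_root t.
Let M v := reflection s (reflection t v).

Let sn_gt0 : 0 < sn.
Proof.
have k0 : (0 : R) < k%:R by rewrite ltr0n (ltn_trans _ k2).
apply: sin_gt0_pi; rewrite divr_gt0 ?pi_gt0 //=.
by rewrite ltr_pdivrMr // ltr_pMr ?pi_gt0 // ltr1n.
Qed.

Let sc : sn ^+ 2 = 1 - c ^+ 2.
Proof. by rewrite /sn /c sin2cos2. Qed.

Let fab : cox_form a b = - (2 * c).
Proof. by rewrite cox_form_simple /cox_form_coef mst. Qed.

Let ME v : M v = v - (cox_form v a + 2 * c * cox_form v b) *: a
   - cox_form v b *: b.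
Proof.
rewrite /M {1}/reflection.
have -> : cox_form (reflection t v) (simple_root s) =
    cox_form v a + 2 * c * cox_form v b.
  rewrite /reflection addrC -scaleNr cox_form_linearl.
  by rewrite [cox_form (simple_root t) _]cox_formC fab; ring.
by rewrite /reflection addrAC.
Qed.

Let M_plane U W : M (U *: a + W *: b) =
  ((4 * c ^+ 2 - 1) * U - 2 * c * W) *: a + (2 * c * U - W) *: b.
Proof.
have fl v : cox_form (U *: a + W *: b) v = U * cox_form a v + W * cox_form b v.
  by rewrite cox_form_linearl -[W *: b]addr0 cox_form_linearl cox_form0l addr0.
rewrite ME !fl [cox_form b a]cox_formC fab !cox_form_simple_diag.
apply/matrixP => i j; rewrite !mxE; ring.
Qed.

Let M_iter (j : nat) U W (phi := 2 * j%:R * th) :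
  sn *: iter j M (U *: a + W *: b) =
   (U * (sin phi * c + cos phi * sn) - W * sin phi) *: a
   + (U * sin phi - W * (sin phi * c - cos phi * sn)) *: b.
Proof.
rewrite {}/phi; elim: j => [|j IHj].
  have -> : 2 * 0%:R * th = 0 by ring.
  by rewrite sin0 cos0 scalerDr !scalerA; congr (_ *: _ + _ *: _); ring.
rewrite iterS; have -> x : sn *: M x = M (sn *: x) by rewrite /M !linearZ.
rewrite IHj M_plane; set phi := 2 * j%:R * th.
have -> : 2 * j.+1%:R * th = phi + (th + th) by rewrite /phi -natr1; ring.
rewrite [sin (phi + _)]sinD [cos (phi + _)]cosD [sin (th + _)]sinD.
rewrite [cos (th + _)]cosD -/c -/sn -!expr2 sc.
by congr (_ *: _ + _ *: _); ring: sc.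
Qed.

Lemma rotation_order v : iter k M v = v.
Proof.
have sn0 : sn != 0 by rewrite gt_eqF.
have sc0 : 1 - c ^+ 2 != 0 by rewrite -sc expf_neq0.
have k0 : (k%:R : R) != 0 by rewrite pnatr_eq0 -lt0n (ltn_trans _ k2).
pose p := cox_form v a; pose q := cox_form v b.
pose x := (p + c * q) / (2 * sn ^+ 2); pose y := (c * p + q) / (2 * sn ^+ 2).
pose v0 := v - (x *: a + y *: b).
have fv0 u : cox_form v0 u = cox_form v u - x * cox_form a u - y * cox_form b u.
  rewrite /v0 opprD -[- (x *: a)]scaleNr -[- (y *: b)]scaleNr.
  by rewrite !cox_formDl !cox_formZl; ring.
have xy : v = v0 + (x *: a + y *: b) by rewrite /v0 subrK.
have MD u w : M (u + w) = M u + M w.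
  by rewrite /M (linearD (reflection t) u w) (linearD (reflection s)).
have iterM j u w : iter j M (u + w) = iter j M u + iter j M w.
  by elim: j => // j IHj; rewrite !iterS IHj MD.
have Mv0 : M v0 = v0.
  rewrite ME !fv0 [cox_form b a]cox_formC fab !cox_form_simple_diag -/p -/q.
  have -> : q - x * - (2 * c) - y * 2 = 0.
    by rewrite /x /y sc; field; exact: sc0.
  have -> : p - x * 2 - y * - (2 * c) + 2 * c * 0 = 0.
    by rewrite /x /y sc; field; exact: sc0.
  by rewrite !scale0r !subr0.
rewrite {1}xy iterM; have -> : iter k M v0 = v0.
  by elim: k => // j; rewrite iterS => ->.
rewrite [RHS]xy; congr (_ + _); apply: (scalerI sn0); rewrite M_iter.
have -> : 2 * k%:R * th = pi *+ 2 by rewrite /th; field; exact: k0.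
rewrite sin2pi cos2pi scalerDr !scalerA; congr (_ *: _ + _ *: _); ring.
Qed.
End Rank2.

Lemma reflection_gl_braid s t k : s != t -> m s t = Some k ->
  (prodR (reflection_gl t) (reflection_gl s) k =
   prodR (reflection_gl s) (reflection_gl t) k)%g.
Proof.
move=> st mst; apply/esym/prodR_braid; try exact: reflection_gl_invol.
apply: val_inj; apply/matrixP => i j.
pose g := (reflection_gl s * reflection_gl t)%g.
have gE l v : val (g ^+ l)%g *m v =
    iter l (fun w => reflection s (reflection t w)) v.
  elim: l => [|l IHl]; first by rewrite expg0 mul1mx.
  by rewrite expgS iterS -IHl -!reflection_mxE !mulmxA.
have := congr1 (fun v : V => v i 0) (rotation_order st mst (delta_mx j 0)).
by rewrite -gE -colE !mxE eqxx andbT.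
Qed.

Lemma reflection_gl_rel (x y : free_group S) : coxeter_rel m x y ->
  free_lift reflection_gl x = free_lift reflection_gl y.
Proof.
case=> [s|s t k st mst].
  by rewrite gmulfXn gmulf1 /= free_lift_gen; exact: reflection_gl_invol.
by rewrite !prodR_morph /= !free_lift_gen; exact: reflection_gl_braid.
Qed.

Fact tits_rep_morphism : group_morphism tits_rep.
Proof. exact: plift_monoid_morphism reflection_gl_rel. Qed.

Lemma tits_rep_gen s v : val (tits_rep (cox_gen m s)) *m v = reflection s v.
Proof. by rewrite /tits_rep /cox_gen (plift_gen reflection_gl_rel) reflection_mxE. Qed.

Definition root_system : set V :=
  [set v | exists s (w : coxeter_group m), v = val (tits_rep w) *m simple_root s].
End RootSystem.
Arguments tits_rep R {S} m _.
Arguments root_system R {S} m _.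

Section EuclideanGroup.
Variables (R : realType) (n : nat).
Local Open Scope ring_scope.

Definition orthogonal_mx : set 'M[R]_n := [set A | A^T *m A = 1%:M].

(* R^n x| O(n), with the subspace topology of R^n x M_n(R); (v, A) stands for
   the isometry x |-> A x + v *)
Definition motion_set : set ('cV[R]_n * 'M[R]_n) :=
  [set g | orthogonal_mx g.2].
Definition euclidean_group : Type := set_type motion_set.
Local Notation E := euclidean_group.
HB.instance Definition _ := Topological.on E.
HB.instance Definition _ := SubChoice.on E.

Lemma orthogonal_mxV (A : 'M[R]_n) : orthogonal_mx A -> A *m A^T = 1%:M.
Proof. exact: mulmx1C. Qed.

Lemma motionP (g : E) : orthogonal_mx (val g).2.
Proof. by have := valP g; rewrite inE. Qed.

Fact motion_one_subproof : (0, 1%:M) \in motion_set.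
Proof. by apply/mem_set; rewrite /motion_set /orthogonal_mx /= trmx1 mul1mx. Qed.
Definition motion_one : E :=
  exist (fun x => x \in motion_set) _ motion_one_subproof.

Fact motion_mul_subproof (g h : E) :
  ((val g).1 + (val g).2 *m (val h).1, (val g).2 *m (val h).2) \in motion_set.
Proof.
apply/mem_set; rewrite /motion_set /orthogonal_mx /= trmx_mul mulmxA.
by rewrite -(mulmxA _ _ (val g).2) motionP mulmx1 motionP.
Qed.
Definition motion_mul (g h : E) : E :=
  exist (fun x => x \in motion_set) _ (motion_mul_subproof g h).

Fact motion_inv_subproof (g : E) :
  (- ((val g).2^T *m (val g).1), (val g).2^T) \in motion_set.
Proof.
apply/mem_set; rewrite /motion_set /orthogonal_mx /= trmxK.
by apply: orthogonal_mxV; exact: motionP.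
Qed.
Definition motion_inv (g : E) : E :=
  exist (fun x => x \in motion_set) _ (motion_inv_subproof g).

Fact motion_mulA : associative motion_mul.
Proof.
by move=> f g h; apply: val_inj; rewrite /= mulmxDr !mulmxA addrA.
Qed.
Fact motion_mul1g : left_id motion_one motion_mul.
Proof. by move=> g; apply: val_inj; rewrite /= !mul1mx add0r -surjective_pairing. Qed.
Fact motion_mulg1 : right_id motion_one motion_mul.
Proof.
by move=> g; apply: val_inj; rewrite /= mulmx0 mulmx1 addr0 -surjective_pairing.
Qed.
Fact motion_mulVg : left_inverse motion_one motion_inv motion_mul.
Proof. by move=> g; apply: val_inj; rewrite /= motionP addNr. Qed.
Fact motion_mulgV : right_inverse motion_one motion_inv motion_mul.
Proof.
move=> g; apply: val_inj; rewrite /= mulmxN mulmxA orthogonal_mxV; last first.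
  exact: motionP.
by rewrite mul1mx subrr.
Qed.
HB.instance Definition _ := isGroup.Build E
  motion_mulA motion_mul1g motion_mulg1 motion_mulVg motion_mulgV.

Definition discrete_subgroup (K : groupClosed E) : Prop :=
  forall x : [set` K], open [set x].

Definition uniform_subgroup (K : groupClosed E) : Prop :=
  compact [set: quotient_topology (cosets K)].

Definition crystallographic (G : groupType) : Prop :=
  exists (K : groupClosed E) (f : G -> E),
    [/\ discrete_subgroup K, uniform_subgroup K, group_morphism f,
        injective f & range f = [set` K]].
End EuclideanGroup.

Section Extension.
Variables (n : nat) (G H : groupType).
Variables (iota : 'cV[int]_n -> G) (eta : G -> H).

(* 0 -> Z^n -> G -> H -> 1 *)
Definition short_exact : Prop :=
  [/\ {morph iota : x y / (x + y)%R >-> x * y}, injective iota,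
      group_morphism eta, range eta = setT &
      range iota = [set g | eta g = 1]].

Definition split_surjection : Prop :=
  exists2 sigma : H -> G, group_morphism sigma & cancel sigma eta.

Definition holonomy_extension : Prop :=
  [/\ short_exact, finite_set [set: H] &
      exists Theta : H -> linear_group int n,
        [/\ group_morphism Theta,
            forall (z : G) (x : 'cV[int]_n),
              iota (val (Theta (eta z)) *m x)%R = z * iota x * z^-1 &
            injective Theta]].
End Extension.

(* Main.v *)
(* PVA is generated by the conjugates of zeta_s = sigma_s tau_s under the section
   s |-> tau_s of pi_P. If w maps alpha_s to alpha_t, then w conjugates zeta_s to
   zeta_t: w is a product of elementary dihedral steps (by the positivity theorem
   for roots), and the mixed relations are exactly these steps. Hence the abelian
   group PVA / PVA' is generated by one element zeta_beta per root beta, permuted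
   by W as the roots are. Conversely sigma_s |-> (e_{alpha_s}, P s),
   tau_s |-> (0, P s), with P the permutation representation of W on the roots,
   defines a morphism from VA to the motions of R^Phi. It kills PVA' and sends
   zeta_beta to the translation by e_beta; so the zeta_beta are independent, and,
   P being faithful, VA / PVA' embeds onto the group of motions Z^Phi x| P W. *)

From HB Require Import structures.
Require Import Defs.
From mathcomp Require Import all_boot all_order all_algebra generic_quotient.
From mathcomp Require Import all_classical all_reals all_analysis.
From mathcomp Require Import ring lra zify.
Import Order.TTheory GRing.Theory Num.Theory.
Import numFieldNormedType.Exports.

Set Implicit Arguments.
Unset Strict Implicit.
Unset Printing Implicit Defensive.

Local Open Scope classical_set_scope.
Local Open Scope group_scope.

Lemma presented_ind (X : choiceType) (rel : free_group X -> free_group X -> Prop)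
    (P : presented_group rel -> Prop) :
  P 1 ->
  (forall x g, P g -> P (pgen rel x * g)) ->
  (forall x g, P g -> P ((pgen rel x)^-1 * g)) ->
  forall g, P g.
Proof.
move=> P1 PM PV; elim/quot_ind; elim/free_ind => u.
elim: u => [|[x b] u IHu]; first by rewrite gmulf1.
have -> : word_class ((x, b) :: u) =
    (if b then (free_gen x)^-1 else free_gen x) * word_class u.
  case: b; rewrite /free_gen; last by rewrite [RHS]free_mulE.
  by rewrite [_^-1]free_invE [RHS]free_mulE.
by rewrite gmulfM; case: b; [rewrite gmulfV; exact: PV|exact: PM].
Qed.

Lemma prodR_addn (G : groupType) (x y : G) (j k : nat) :
  prodR x y (j + k) =
  (if odd k then prodR y x j else prodR x y j) * prodR x y k.
Proof.
elim: k x y => [|k IHk] x y; first by rewrite addn0 mulg1.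
by rewrite addnS [LHS]/= IHk /= mulgA; case: (odd k).
Qed.

(** * Word length and dihedral cosets *)

Section Length.
Variables (S : finType) (m : coxeter_matrix S).
Local Notation W := (coxeter_group m).
Local Notation g := (cox_gen m).
Implicit Types (w v : W) (s t : S) (u : seq S).

Lemma cox_genV s : (g s)^-1 = g s.
Proof. by apply: mulg1_eq; exact: cox_gen_invol. Qed.

Lemma cox_genK s : involutive (fun w => w * g s).
Proof. by move=> w; rewrite -mulgA cox_gen_invol mulg1. Qed.

Lemma cox_ind (P : W -> Prop) :
  P 1 -> (forall s w, P w -> P (g s * w)) -> forall w, P w.
Proof.
move=> P1 PM; apply: presented_ind => // s w Pw.
by rewrite -/(cox_gen m s) cox_genV; exact: PM.
Qed.

Lemma reduced_word_subproof w :
  exists k, `[< exists2 u, \prod_(s <- u) g s = w & size u = k >].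
Proof.
elim/cox_ind: w => [|s w [k /asboolP[u uw uk]]].
  by exists 0; apply/asboolP; exists [::]; rewrite ?big_nil.
by exists k.+1; apply/asboolP; exists (s :: u); rewrite ?big_cons ?uw //= uk.
Qed.

Definition cox_length w : nat := ex_minn (reduced_word_subproof w).
Local Notation len := cox_length.

Lemma reduced_word w : exists2 u, \prod_(s <- u) g s = w & size u = len w.
Proof. by rewrite /cox_length; case: ex_minnP => k /asboolP. Qed.

Lemma cox_length_prod u : len (\prod_(s <- u) g s) <= size u.
Proof.
rewrite /cox_length; case: ex_minnP => k _; apply.
by apply/asboolP; exists u.
Qed.

Lemma cox_lengthM w v : len (w * v) <= len w + len v.
Proof.
have [a <- <-] := reduced_word w; have [b <- <-] := reduced_word v.
by rewrite -size_cat -big_cat cox_length_prod.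
Qed.

Lemma cox_length1 : len 1 = 0.
Proof. by apply/eqP; have := cox_length_prod [::]; rewrite big_nil leqn0. Qed.

Lemma cox_length_gen s : len (g s) <= 1.
Proof. by have := cox_length_prod [:: s]; rewrite big_seq1. Qed.

Lemma cox_length_prodR s t k : len (prodR (g s) (g t) k) <= k.
Proof.
elim: k s t => [|k IHk] s t /=; first by rewrite cox_length1.
rewrite (leq_trans (cox_lengthM _ _)) // -addn1.
by rewrite leq_add ?IHk ?cox_length_gen.
Qed.

Lemma cox_descent w : w <> 1 -> exists s, len (w * g s) < len w.
Proof.
have [u <-] := reduced_word w; case/lastP: u => [|u s]; first by rewrite big_nil.
rewrite size_rcons big_rcons /= => <- _; exists s.
by rewrite cox_genK ltnS cox_length_prod.
Qed.

(* w = v x with v of minimal length in its coset of <s, t> and x alternating *)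
Lemma dihedral_coset_decomposition s t w : exists v x y k,
  [/\ (x, y) = (s, t) \/ (x, y) = (t, s), w = v * prodR (g x) (g y) k,
      len w = len v + k, len v <= len (v * g s) & len v <= len (v * g t)].
Proof.
elim: {w}(len w) {-2}w (leqnn (len w)) => [|l IHl] w.
  by rewrite leqn0 => /eqP w0; exists w, s, t, 0; rewrite w0 mulg1; split; auto.
move=> wl; have step a b : (a, b) = (s, t) \/ (a, b) = (t, s) ->
    len (w * g b) < len w -> exists v x y k,
  [/\ (x, y) = (s, t) \/ (x, y) = (t, s), w = v * prodR (g x) (g y) k,
      len w = len v + k, len v <= len (v * g s) & len v <= len (v * g t)].
  move=> ab wb; case: (IHl (w * g b)); first by lia.
  move=> v [x [y [k [xy wE lE vs vt]]]].
  have wle : len w <= (len (w * g b)).+1.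
    rewrite -{1}(cox_genK b w) -addn1.
    by rewrite (leq_trans (cox_lengthM _ _)) ?leq_add2l ?cox_length_gen.
  case: k wE lE => [|k] wE lE.
    exists v, a, b, 1%N; split=> //=; last by lia.
    by rewrite mul1g -[LHS](cox_genK b) wE mulg1.
  have [yb|/eqP yb] := eqVneq y b.
    have wE' : w = v * prodR (g y) (g x) k.
      by rewrite -[LHS](cox_genK b) wE /= yb mulgA cox_genK.
    have := cox_lengthM v (prodR (g y) (g x) k); rewrite -wE'.
    have := cox_length_prodR y x k; lia.
  have [xb ya] : x = b /\ y = a.
    by case: ab xy yb => -[-> ->] [] [-> ->].
  exists v, a, b, k.+2; split=> //; last by lia.
  by rewrite -[LHS](cox_genK b) wE -xb -ya /= !mulgA.
have [ws|ws] := leqP (len w) (len (w * g s)); last by apply: (step t s); auto.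
have [wt|wt] := leqP (len w) (len (w * g t)); last by apply: (step s t); auto.
by exists w, s, t, 0; rewrite mulg1 addn0; split; auto.
Qed.

Lemma dihedral_coset_ascent s t w : s != t -> len w <= len (w * g s) ->
  exists v k, [/\ w = v * prodR (g s) (g t) k, len w = len v + k,
    len v <= len (v * g s), len v <= len (v * g t) &
    forall M, m s t = Some M -> k < M].
Proof.
move=> st ws; have [v [x [y [k [xy wE lE vs vt]]]]] :=
  dihedral_coset_decomposition s t w.
have short a b z j : len z + j < k -> w * g s <> v * z * prodR (g a) (g b) j.
  move=> zk wsE; have := cox_lengthM (v * z) (prodR (g a) (g b) j).
  rewrite -wsE; have := cox_lengthM v z; have := cox_length_prodR a b j; lia.
have {xy} wE' : w = v * prodR (g s) (g t) k.
  case: xy wE => -[-> ->] //; case: k {lE} short => // k short wE.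
  case: (short s t 1 k); first by rewrite cox_length1.
  by rewrite wE mulg1 /= mulgA cox_genK.
exists v, k; split=> // M mst; rewrite ltnNge; apply/negP => Mk.
case: M mst Mk (cox_offdiag st mst) => // M mst Mk _.
pose a := if odd M.+1 then t else s; pose b := if odd M.+1 then s else t.
case: (short s t (prodR (g a) (g b) (k - M.+1)) M).
  by have := cox_length_prodR a b (k - M.+1); lia.
rewrite wE' -[in LHS](subnK Mk) prodR_addn -(cox_gen_braid st mst).
rewrite -mulgA -[_ * g s]mulgA [prodR _ _ M.+1]/= cox_genK mulgA.
by rewrite /a /b; case: (odd _).
Qed.
End Length.

(** * Positivity of roots *)

Section RootAction.
Variables (R : realType) (S : finType) (m : coxeter_matrix S).
Local Notation W := (coxeter_group m).
Local Notation g := (cox_gen m).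
Local Notation len := (@cox_length S m).
Local Notation V := 'cV[R]_#|S|.
Local Notation root := (@simple_root R S).
Implicit Types (w : W) (s t : S) (v : V).
Local Open Scope ring_scope.

Definition root_act w v : V := val (tits_rep R m w) *m v.
Local Notation "w ∙ v" := (root_act w v) (at level 40).

Lemma root_actM w1 w2 v : (w1 * w2)%g ∙ v = w1 ∙ (w2 ∙ v).
Proof. by rewrite /root_act (tits_rep_morphism R m).2 /= mulmxA. Qed.

Lemma root_act1 v : 1%g ∙ v = v.
Proof. by rewrite /root_act (tits_rep_morphism R m).1 /= mul1mx. Qed.

Lemma root_act_gen s v : g s ∙ v = reflection m s v.
Proof. exact: tits_rep_gen. Qed.

Lemma root_actD w v1 v2 : w ∙ (v1 + v2) = w ∙ v1 + w ∙ v2.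
Proof. exact: mulmxDr. Qed.

Lemma root_actZ w (a : R) v : w ∙ (a *: v) = a *: (w ∙ v).
Proof. by rewrite /root_act -scalemxAr. Qed.

Lemma root_actK w : cancel (root_act w) (root_act w^-1%g).
Proof. by move=> v; rewrite -root_actM mulVg root_act1. Qed.

Lemma root_actVK w : cancel (root_act w^-1%g) (root_act w).
Proof. by move=> v; rewrite -root_actM mulgV root_act1. Qed.

Lemma root_act_inj w : injective (root_act w).
Proof. exact: can_inj (root_actK w). Qed.

Lemma root_act0 w : w ∙ 0 = 0.
Proof. exact: mulmx0. Qed.

Lemma root_actN w v : w ∙ (- v) = - (w ∙ v).
Proof. exact: mulmxN. Qed.

Lemma root_act_simple s : g s ∙ root s = - root s.
Proof.
rewrite root_act_gen /reflection cox_form_simple_diag.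
by rewrite scaler_nat mulr2n opprD addrA subrr add0r.
Qed.

(* sin (k pi / m) / sin (pi / m) for m = m_{s,t} finite, and k for m infinite *)
Fixpoint dihedral_coef s t (k : nat) : R :=
  if k is k'.+1 then
    if k' is k''.+1 then
      - cox_form_coef R m s t * dihedral_coef s t k' - dihedral_coef s t k''
    else 1
  else 0.
Local Notation coef := dihedral_coef.
Arguments dihedral_coef : simpl never.

Lemma dihedral_coefSS s t k : coef s t k.+2 =
  - cox_form_coef R m s t * coef s t k.+1 - coef s t k.
Proof. by []. Qed.

Lemma dihedral_coefC s t k : coef s t k = coef t s k.
Proof.
elim: k {-2}k (leqnn k) => [|n IHn] [|[|k]] // kn.
by rewrite !dihedral_coefSS cox_form_coefC !IHn //; lia.
Qed.

Section Finite.
Variables (s t : S) (M : nat).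
Hypotheses (st : s != t) (mst : m s t = Some M).
Let th : R := pi / M%:R.

Let M_gt0 : (0 : R) < M%:R.
Proof. by rewrite ltr0n (ltn_trans _ (cox_offdiag st mst)). Qed.

Let angle_gt0 k : (0 < k)%N -> (k < M)%N -> 0 < sin (k%:R * th).
Proof.
move=> k0 kM; apply: sin_gt0_pi; rewrite mulrA.
rewrite divr_gt0 ?mulr_gt0 ?pi_gt0 ?ltr0n ?(ltn_trans k0 kM) //=.
by rewrite ltr_pdivrMr // mulrC ltr_pM2l ?pi_gt0 // ltr_nat.
Qed.

Let sin_th : 0 < sin th.
Proof. by rewrite -[th]mul1r (@angle_gt0 1) // (cox_offdiag st mst). Qed.

Lemma dihedral_coefE k : sin th * coef s t k = sin (k%:R * th).
Proof.
elim: k {-2}k (leqnn k) => [|n IHn] [|[|k]] // kn.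
- by rewrite mul0r sin0 mulr0.
- by rewrite mul0r sin0 mulr0.
- by rewrite mul1r mulr1.
rewrite dihedral_coefSS mulrBr mulrCA !IHn //; try lia.
rewrite /cox_form_coef mst -/th opprK.
have -> : k.+2%:R * th = k.+1%:R * th + th by rewrite -[k.+2]addn1 natrD; ring.
have -> : k%:R * th = k.+1%:R * th - th by rewrite -[k.+1]addn1 natrD; ring.
by rewrite !sinD sinN cosN; ring.
Qed.

Lemma dihedral_coef_sym k : (k <= M)%N -> coef s t (M - k) = coef s t k.
Proof.
move=> kM; apply: (mulfI (lt0r_neq0 sin_th)); rewrite !dihedral_coefE.
rewrite natrB // mulrBl; have -> : M%:R * th = pi.
  by rewrite /th mulrC divfK // lt0r_neq0.
by rewrite sinB sinpi cospi; ring.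
Qed.

Lemma dihedral_coef_finite_gt0 k : (0 < k)%N -> (k < M)%N -> 0 < coef s t k.
Proof. by move=> k0 kM; rewrite -(pmulr_rgt0 _ sin_th) dihedral_coefE angle_gt0. Qed.
End Finite.

Lemma dihedral_coef_infinite s t k : m s t = None -> coef s t k = k%:R.
Proof.
move=> mst; elim: k {-2}k (leqnn k) => [|n IHn] [|[|k]] // kn.
rewrite dihedral_coefSS !IHn /cox_form_coef ?mst; try lia.
by rewrite -[k.+2]addn2 -[k.+1]addn1 !natrD; ring.
Qed.

Lemma dihedral_coef_gt0 s t k : s != t -> (0 < k)%N ->
  (forall M, m s t = Some M -> (k < M)%N) -> 0 < coef s t k.
Proof.
move=> st k0; case mst: (m s t) => [M|] kM.
  by apply: (dihedral_coef_finite_gt0 st mst) => //; exact: kM.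
by rewrite dihedral_coef_infinite // ltr0n.
Qed.

Lemma dihedral_coef_ge0 s t k : s != t ->
  (forall M, m s t = Some M -> (k <= M)%N) -> 0 <= coef s t k.
Proof.
move=> st kM; case: k kM => // k kM; case mst: (m s t) => [M|]; last first.
  by rewrite dihedral_coef_infinite.
have := kM _ mst; rewrite leq_eqVlt => /predU1P[->|kM'].
  by rewrite -(dihedral_coef_sym st mst) // subnn.
by rewrite ltW // (dihedral_coef_finite_gt0 st mst).
Qed.

Lemma root_act_dihedral a b k :
  g b ∙ (coef a b k.+1 *: root a + coef a b k *: root b) =
  coef a b k.+2 *: root b + coef a b k.+1 *: root a.
Proof.
rewrite dihedral_coefSS; move: (coef a b k.+1) (coef a b k) => c1 c0.
rewrite root_actD !root_actZ root_act_simple root_act_gen /reflection.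
by rewrite cox_form_simple; apply/matrixP => i j; rewrite !mxE; ring.
Qed.

Lemma prodR_simple_root s t k : s != t ->
  prodR (g s) (g t) k ∙ root s =
  coef s t k.+1 *: root (if odd k then t else s) +
  coef s t k *: root (if odd k then s else t).
Proof.
move=> st; elim: k => [|k IHk]; first by rewrite root_act1 scale1r scale0r addr0.
rewrite prodRSl root_actM IHk oddS.
case: (odd k); last by rewrite root_act_dihedral.
by rewrite ![coef s t _]dihedral_coefC root_act_dihedral.
Qed.

Definition nonneg v := forall i, 0 <= v i 0.

Lemma nonneg_simple s : nonneg (root s).
Proof. by move=> i; rewrite mxE ler0n. Qed.

Lemma nonnegD v1 v2 : nonneg v1 -> nonneg v2 -> nonneg (v1 + v2).
Proof. by move=> v1_ge0 v2_ge0 i; rewrite mxE addr_ge0. Qed.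

Lemma nonnegZ (a : R) v : 0 <= a -> nonneg v -> nonneg (a *: v).
Proof. by move=> a0 v0 i; rewrite mxE mulr_ge0. Qed.

Lemma nonneg_antisym v : nonneg v -> nonneg (- v) -> v = 0.
Proof.
move=> v0 v0'; apply/matrixP => i j; rewrite ord1 mxE; apply: le_anti.
by rewrite v0 andbT -oppr_ge0; have := v0' i; rewrite mxE.
Qed.

Lemma simple_root_neq0 s : root s != 0.
Proof.
apply/eqP => /matrixP/(_ (enum_rank s) 0)/eqP.
by rewrite !mxE !eqxx oner_eq0.
Qed.

Lemma root_act_nonneg w s : (len w <= len (w * g s)%g)%N -> nonneg (w ∙ root s).
Proof.
elim: {w}(len w) {-2}w s (leqnn (len w)) => [|l IHl] w s wl ws.
  have [->|/eqP w1] := eqVneq w 1%g; last by have [] := cox_descent w1; lia.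
  by rewrite root_act1; exact: nonneg_simple.
have [->|/eqP w1] := eqVneq w 1%g; first by rewrite root_act1; exact: nonneg_simple.
have [t wt] := cox_descent w1.
have st : s != t by apply/eqP => st; rewrite -st in wt; lia.
have [v [k [wE lE vs vt kM]]] := dihedral_coset_ascent st ws.
have vl : (len v <= l)%N.
  case: k wE lE {kM} => [|k] wE lE; last by lia.
  by move: wt vt; rewrite wE mulg1; lia.
rewrite wE root_actM prodR_simple_root // root_actD !root_actZ.
by apply: nonnegD; apply: nonnegZ; rewrite ?dihedral_coef_ge0 //;
  do 1?[case: odd; exact: IHl]; move=> M /kM // /ltnW.
Qed.

Lemma root_act_nonpos w s : (len (w * g s)%g < len w)%N -> nonneg (- (w ∙ root s)).
Proof.
move=> ws; rewrite -root_actN -root_act_simple -root_actM.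
by apply: root_act_nonneg; rewrite cox_genK ltnW.
Qed.

Lemma root_act_nonneg_length w s :
  nonneg (w ∙ root s) -> (len w <= len (w * g s)%g)%N.
Proof.
move=> ws; rewrite leqNgt; apply/negP => /root_act_nonpos/(nonneg_antisym ws)/eqP.
by rewrite -[0](root_act0 w) (inj_eq (@root_act_inj w)) (negPf (simple_root_neq0 s)).
Qed.

Lemma root_act_faithful w : (forall s, w ∙ root s = root s) -> w = 1%g.
Proof.
move=> wid; have [//|/eqP/cox_descent[s]] := eqVneq w 1%g.
by rewrite ltnNge root_act_nonneg_length // wid; exact: nonneg_simple.
Qed.

(* A relation [x a + y b = root t] with [x, y > 0] and [a, b] nonnegative makes
   [a] and [b] collinear. *)
Lemma simple_root_extremal w s1 s2 t (x y : R) : s1 != s2 -> 0 < x -> 0 < y ->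
  nonneg (w ∙ root s1) -> nonneg (w ∙ root s2) ->
  x *: (w ∙ root s1) + y *: (w ∙ root s2) <> root t.
Proof.
move=> s12 x0 y0 w1 w2 eqt; pose k := enum_rank t.
have out i : i != k -> (w ∙ root s1) i 0 = 0 /\ (w ∙ root s2) i 0 = 0.
  move: (_ ∙ _) (_ ∙ _) w1 w2 eqt => u1 u2 u1_ge0 u2_ge0 /matrixP/(_ i 0) + ik.
  rewrite !mxE (negPf ik) /= => /eqP.
  rewrite paddr_eq0 ?mulr_ge0 ?(u1_ge0 i) ?(u2_ge0 i) 1?ltW //.
  by rewrite !mulf_eq0 (gt_eqF x0) (gt_eqF y0) /= => /andP[/eqP-> /eqP->].
pose a := (w ∙ root s1) k 0; pose b := (w ∙ root s2) k 0.
have /root_act_inj/matrixP/(_ (enum_rank s1) 0) :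
    w ∙ (b *: root s1) = w ∙ (a *: root s2).
  apply/matrixP => i j; rewrite ord1 !root_actZ [LHS]mxE [RHS]mxE.
  have [->|ik] := eqVneq i k; first by rewrite -/a -/b mulrC.
  by have [-> ->] := out i ik; rewrite !mulr0.
rewrite !mxE !eqxx (inj_eq enum_rank_inj) (negPf s12) mulr0 mulr1 => b0.
have /root_act_inj/matrixP/(_ (enum_rank s2) 0)/eqP : w ∙ root s2 = w ∙ 0.
  apply/matrixP => i j; rewrite ord1 root_act0 [RHS]mxE.
  by have [->|/out[_ ->]//] := eqVneq i k.
by rewrite !mxE !eqxx oner_eq0.
Qed.

(* The last dihedral factor of [w] maps [root s] to a simple root: it is the
   alternating word that appears in the mixed relations. *)
Lemma simple_to_simple w s t : w <> 1%g -> w ∙ root s = root t ->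
  exists (v : W) r b M, [/\ s != r, m s r = Some M, (len v < len w)%N,
    b = (if odd M then r else s) /\ w = (v * prodR (g s) (g r) M.-1)%g &
    v ∙ root b = root t].
Proof.
move=> w1 wst; have [r wr] := cox_descent w1.
have ws : (len w <= len (w * g s)%g)%N.
  by apply: root_act_nonneg_length; rewrite wst; exact: nonneg_simple.
have sr : s != r by apply/eqP => sr; rewrite -sr in wr; lia.
have [v [k [wE lE vs vr kM]]] := dihedral_coset_ascent sr ws.
have k0 : (0 < k)%N.
  by case: k wE lE {kM} => // wE lE; move: wr vr; rewrite wE mulg1; lia.
have wE' : coef s r k.+1 *: (v ∙ root (if odd k then r else s)) +
    coef s r k *: (v ∙ root (if odd k then s else r)) = root t.
  by rewrite -wst wE root_actM prodR_simple_root // root_actD !root_actZ.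
have ck := dihedral_coef_gt0 sr k0 kM.
have vsn := root_act_nonneg vs; have vrn := root_act_nonneg vr.
case mst: (m s r) => [M|]; last first.
  case: (simple_root_extremal _ _ ck _ _ wE').
  - by case: odd => //; rewrite eq_sym.
  - by rewrite dihedral_coef_infinite ?ltr0n.
  - by case: odd.
  - by case: odd.
have [kM1|kM1] := ltnP k.+1 M.
  case: (simple_root_extremal _ _ ck _ _ wE').
  - by case: odd => //; rewrite eq_sym.
  - by apply: dihedral_coef_gt0 => // M'; rewrite mst => -[<-].
  - by case: odd.
  - by case: odd.
have {kM1} kE : k.+1 = M by have := kM _ mst; lia.
exists v, r, (if odd M then r else s), M; split=> //; first by lia.
  by rewrite -kE.
move: wE'; rewrite kE.
have -> : coef s r M = 0 by rewrite -(dihedral_coef_sym sr mst) // subnn.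
have -> : coef s r k = 1.
  by rewrite -(dihedral_coef_sym sr mst) -kE ?subSnn.
by rewrite scale0r scale1r add0r -kE /=; case: (odd k).
Qed.
End RootAction.
Arguments dihedral_coef : simpl never.

Section QuotientLift.
Variables (G H : groupType) (N : normalClosed G) (f : UMagmaMorphism.type G H).
Hypothesis fN : forall x, x \in N -> f x = 1.

Definition quot_lift (q : quotient_group N) : H := f (repr q).

Lemma quot_lift_pi x : quot_lift (quot_pi N x) = f x.
Proof.
have := fN (quot_repr N x); rewrite gmulfM gmulfV => fx.
by rewrite /quot_lift -[RHS]mulg1 -fx mulVKg.
Qed.

Fact quot_lift_morphism : group_morphism quot_lift.
Proof.
split; first by have := quot_lift_pi 1; rewrite !gmulf1.
by elim/quot_ind=> x; elim/quot_ind=> y; rewrite -gmulfM !quot_lift_pi gmulfM.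
Qed.
End QuotientLift.

Lemma derived_ker (G H : groupType) (N : normalClosed G)
    (f : UMagmaMorphism.type G H) :
  {in N &, forall x y, commute (f x) (f y)} ->
  forall x, x \in derived N -> f x = 1.
Proof.
move=> fN x /generatedP/(_ (gker f)); rewrite inE => h; apply/eqP/h.
move=> _ [a [b [Na Nb ->]]]; rewrite inE gmulfR; apply/commgP; exact: fN.
Qed.

(** * The section of the virtual Artin group *)

Section VirtualArtinSection.
Variables (S : finType) (m : coxeter_matrix S).
Local Notation W := (coxeter_group m).
Local Notation VA := (virtual_artin_group m).
Local Notation g := (cox_gen m).
Local Notation sigma := (va_sigma m).
Local Notation tau := (va_tau m).
Implicit Types (w : W) (s t : S).

Lemma va_tau_invol s : tau s * tau s = 1.
Proof. by have /presented_rel := VATauInvol m s; rewrite gmulfXn gmulf1. Qed.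

Lemma va_tau_braid s t k : s != t -> m s t = Some k ->
  prodR (tau t) (tau s) k = prodR (tau s) (tau t) k.
Proof.
by move=> st mst; have /presented_rel := VATauBraid st mst; rewrite !prodR_morph.
Qed.

Lemma va_mixed s t k : s != t -> m s t = Some k ->
  prodR (tau s) (tau t) k.-1 * sigma s =
  sigma (if odd k then t else s) * prodR (tau s) (tau t) k.-1.
Proof.
move=> st mst; have /presented_rel := VAMixed st mst.
by rewrite !gmulfM !prodR_morph.
Qed.

Definition va_section : W -> VA := plift tau.

Lemma va_tau_rel u v : coxeter_rel m u v -> free_lift tau u = free_lift tau v.
Proof.
case=> [s|s t k st mst].
  by rewrite gmulfXn gmulf1 /= free_lift_gen; exact: va_tau_invol.
by rewrite !prodR_morph /= !free_lift_gen; exact: va_tau_braid.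
Qed.

Fact va_section_morphism : group_morphism va_section.
Proof. exact: plift_monoid_morphism va_tau_rel. Qed.
HB.instance Definition _ := isUMagmaMorphism.Build W VA va_section va_section_morphism.

Lemma va_section_gen s : va_section (g s) = tau s.
Proof. exact: (plift_gen va_tau_rel). Qed.

Lemma va_sectionK : cancel va_section (@pi_P S m).
Proof.
elim/cox_ind=> [|s w IHw]; first by rewrite !gmulf1.
by rewrite !gmulfM /= IHw va_section_gen pi_P_tau.
Qed.

Definition va_zeta s : VA := sigma s * tau s.

Lemma va_zeta_pure s : va_zeta s \in PVA m.
Proof. by rewrite inE gmulfM /= pi_P_sigma pi_P_tau cox_gen_invol. Qed.

Lemma va_mixed_zeta s t k : s != t -> m s t = Some k ->
  prodR (tau s) (tau t) k.-1 * va_zeta s =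
  va_zeta (if odd k then t else s) * prodR (tau s) (tau t) k.-1.
Proof.
move=> st mst; rewrite /va_zeta mulgA va_mixed // -!mulgA; congr (_ * _).
have := va_tau_braid st mst; have := cox_offdiag st mst.
case: k {mst} => // k _; rewrite [LHS]/= => ->.
by rewrite prodRSl /=; case: (odd k).
Qed.

Lemma va_section_zeta (R : realType) w s t :
  root_act w (simple_root R s) = simple_root R t ->
  va_section w * va_zeta s = va_zeta t * va_section w.
Proof.
elim: {w}(cox_length w) {-2}w s (leqnn (cox_length w)) => [|l IHl] w s wl wst.
  have [w1|/eqP w1] := eqVneq w 1; last by have [] := cox_descent w1; lia.
  move: wst; rewrite w1 root_act1 gmulf1 mul1g mulg1 => /matrixP/(_ (enum_rank s) 0)%R.
  rewrite !mxE eqxx (inj_eq enum_rank_inj) /=.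
  by case: eqP => [->//|_ /eqP]; rewrite oner_eq0.
have [w1|/eqP w1] := eqVneq w 1; first by apply: IHl wst; rewrite w1 cox_length1.
have [v [r [b [M [sr msr vw [bE wE] vb]]]]] := simple_to_simple w1 wst.
rewrite wE gmulfM prodR_morph /= !va_section_gen -mulgA va_mixed_zeta //.
by rewrite -bE mulgA (IHl v b) ?[RHS]mulgA //; lia.
Qed.
End VirtualArtinSection.

(** * Discrete and uniform groups of motions *)

Section MatrixCompactness.
Variables (R : realType) (p q : nat).
Local Open Scope ring_scope.

Lemma mx_continuous (T : topologicalType) (f : T -> 'M[R]_(p, q)) :
  (forall i j, continuous (fun x => f x i j)) -> continuous f.
Proof.
move=> fc x A [B Bnbhs BA].
have : \forall y \near x, forall i j, B i j (f y i j).
  by apply: filter_forall => i; apply: filter_forall => j; exact/fc/Bnbhs.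
by apply: filterS => y By; exact: BA.
Qed.

Lemma mx_box_compact (c : R) : compact [set M : 'M[R]_(p, q) | forall i j, `|M i j| <= c].
Proof.
have -> : [set M : 'M[R]_(p, q) | forall i j, `|M i j| <= c] =
    vec_mx @` [set v : 'rV[R]_(p * q) | forall k, `[- c, c]%classic (v 0 k)].
  apply/seteqP; split=> [M Mc|_ [v vc <-] i j].
    exists (mxvec M); last exact: mxvecK.
    by move=> k; case/mxvec_indexP: k => i j; rewrite mxvecE /= in_itv /= -ler_norml.
  by have := vc (mxvec_index i j); rewrite mxE /= in_itv /= -ler_norml.
apply: continuous_compact.
  apply: continuous_subspaceT; apply: mx_continuous => i j.
  under eq_fun do rewrite mxE.
  exact: coord_continuous.
by apply: (@rV_compact _ _ (fun=> `[- c, c]%classic)) => k; exact: segment_compact.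
Qed.
End MatrixCompactness.

Lemma compact_set_type (X : topologicalType) (A : set X) (C : set A) :
  compact (set_val @` C) -> compact C.
Proof.
move=> cC F FF FC; pose G := fmap (set_val : A -> X) F.
have GC : G (set_val @` C) by apply: (filterS (_ : C `<=` _) FC) => a Ca; exists a.
have [x [[a Ca <-] clG]] := cC G _ GC.
exists a; split=> // U V FU [_ [[B oB <-] /= Ba BV]].
have GU : G (set_val @` U) by apply: (filterS (_ : U `<=` _) FU) => b Ub; exists b.
have [y [[b Ub <-] Bb]] := clG _ B GU (open_nbhs_nbhs (conj oB Ba)).
by exists b; split=> //; exact: BV.
Qed.

Section EuclideanSubgroups.
Variables (R : realType) (n : nat).
Local Notation E := (euclidean_group R n).
Local Open Scope ring_scope.

Lemma translation_subproof (x : 'cV[R]_n) : (x, 1%:M) \in @motion_set R n.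
Proof. by apply/mem_set; rewrite /motion_set /orthogonal_mx /= trmx1 mul1mx. Qed.
Definition translation (x : 'cV[R]_n) : E :=
  exist (fun g => g \in @motion_set R n) _ (translation_subproof x).

Lemma translationD x y : translation (x + y) = (translation x * translation y)%g.
Proof. by apply: val_inj; rewrite /= mul1mx mulmx1. Qed.

Lemma translation0 : translation 0 = 1%g.
Proof. exact: val_inj. Qed.

Lemma int_ball_eq (x y : R) : x \is a Num.int -> y \is a Num.int -> `|x - y| < 1 -> x = y.
Proof.
move=> xZ yZ; rewrite ltNge => xy; apply/eqP; rewrite -subr_eq0.
by apply: contraNT xy; apply: norm_intr_ge1; rewrite rpredB.
Qed.

Lemma integral_discrete (K : groupClosed E) :
  (forall g, g \in K -> (forall i, (val g).1 i 0 \is a Num.int) /\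
                        (forall i j, (val g).2 i j \is a Num.int)) ->
  discrete_subgroup K.
Proof.
move=> KZ x; rewrite openE => _ ->.
have xball : nbhs (val (val x)) (ball (val (val x)) 1) by exact: nbhsx_ballx.
have c2 : continuous (set_val : E -> _) by exact: initial_continuous.
have c1 : continuous (set_val : [set` K] -> _) by exact: initial_continuous.
apply: (filterS (_ : _ `<=` [set x]) (c1 x _ (c2 (val x) _ xball))).
move=> y [[_ ball1] [_ ball2]].
have [x1 x2] := KZ _ (set_mem (valP x)).
have [y1 y2] := KZ _ (set_mem (valP y)).
apply/val_inj/val_inj/esym; rewrite [LHS]surjective_pairing [RHS]surjective_pairing.
congr (_, _); apply/matrixP => i j; apply: int_ball_eq => //; rewrite ?ord1 //.
- exact: ball1.
- exact: ball2.
Qed.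

Lemma orthogonal_mx_le1 (A : 'M[R]_n) i j : orthogonal_mx A -> `|A i j| <= 1.
Proof.
move=> /orthogonal_mxV/matrixP/(_ i i); rewrite !mxE eqxx => Aii.
rewrite -(@expr_le1 _ 2) // real_normK ?num_real // -[leRHS]Aii (bigD1 j) //= !mxE.
rewrite expr2 lerDl.
by apply: sumr_ge0 => k _; rewrite !mxE -expr2 sqr_ge0.
Qed.

Lemma motion_set_closed : closed (@motion_set R n).
Proof.
have -> : @motion_set R n = \bigcap_(ij in [set: 'I_n * 'I_n])
    [set p : 'cV[R]_n * 'M[R]_n | \sum_k p.2 k ij.1 * p.2 k ij.2 = (ij.1 == ij.2)%:R].
  apply/seteqP; split=> [p /matrixP pO [i j] _|p pO] /=.
    by have := pO i j; rewrite !mxE => <-; apply: eq_bigr => k _; rewrite mxE.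
  apply/matrixP => i j; rewrite !mxE -(pO (i, j)) //.
  by apply: eq_bigr => k _; rewrite mxE.
apply: closed_bigI => -[i j] _.
pose f (p : 'cV[R]_n * 'M[R]_n) := \sum_k p.2 k i * p.2 k j.
apply: (@preimage_closed _ _ f [set x | x = _]); last exact: closed_eq.
move=> p _; apply: cvg_big => [|k _]; first exact: add_continuous.
have entry l : {for p, continuous (fun p : 'cV[R]_n * 'M[R]_n => p.2 k l)}.
  apply: (@continuous_comp _ _ _ snd (fun A : 'M[R]_n => A k l)).
    exact: cvg_snd.
  exact: coord_continuous.
by apply: continuousM; exact: entry.
Qed.

Lemma translation_lattice_uniform (K : groupClosed E) :
  (forall x : 'cV[int]_n, translation (map_mx intr x) \in K) -> uniform_subgroup K.
Proof.
move=> KT; pose C : set E := [set g : E | forall i : 'I_n, `|(val g).1 i 0| <= n%:R].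
have cC : compact C.
  apply: compact_set_type.
  have -> : set_val @` C = ([set v : 'cV[R]_n | forall i j, `|v i j| <= n%:R] `*`
      [set A : 'M[R]_n | forall i j, `|A i j| <= 1]) `&` @motion_set R n.
    apply/seteqP; split=> [_ [g gC <-]|p [[p1 p2] pO]].
      split; last exact: motionP.
      by split=> i j; [rewrite ord1; exact: gC|exact/orthogonal_mx_le1/motionP].
    by exists (exist _ p (mem_set pO)).
  apply: compact_closedI motion_set_closed.
  by apply: compact_setX; exact: mx_box_compact.
rewrite /uniform_subgroup; set Q := quotient_topology _.
have -> : [set: Q] = \pi_Q%qT @` C.
  apply/seteqP; split=> // q _; rewrite -[q]reprK; set g := repr q.
  pose A := (val g).2; pose y := A^T *m (val g).1.
  pose z : 'cV[int]_n := - map_mx Num.floor y.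
  exists (g * translation (map_mx intr z))%g; last first.
    by apply/esym/(cosetP K); rewrite mulKg.
  move=> i; have gE : (val g).1 = A *m y.
    by rewrite mulmxA orthogonal_mxV ?mul1mx //; exact: motionP.
  rewrite [(val _).1]/= -/A gE -mulmxDr mxE (le_trans (ler_norm_sum _ _ _)) //.
  rewrite -[n in leRHS]card_ord -sum1_card natr_sum ler_sum // => k _.
  rewrite normrM mulr_ile1 ?orthogonal_mx_le1 //; first exact: motionP.
  rewrite !mxE intrN ler_norml; have /andP[f0 f1] := floor_itv (y k 0).
  by rewrite intrD in f1; apply/andP; split; move: f0 f1; rewrite !mxE; lra.
apply: continuous_compact cC; apply: continuous_subspaceT; exact: pi_continuous.
Qed.
End EuclideanSubgroups.

(** * The action on the lattice of roots *)

Section RootPermutation.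
Variables (R : realType) (S : finType) (m : coxeter_matrix S) (n : nat).
Variable phi : 'I_n -> 'cV[R]_#|S|.
Hypotheses (phi_inj : injective phi) (phi_range : range phi = root_system R m).
Local Notation W := (coxeter_group m).
Local Notation g := (cox_gen m).
Local Notation V := 'cV[R]_#|S|.
Local Notation root := (@simple_root R S).
Local Notation "w ∙ v" := (@root_act R S m w v) (at level 40).
Implicit Types (w : W) (s t : S) (v : V).
Local Open Scope ring_scope.

Lemma rootP i : exists s w, phi i = w ∙ root s.
Proof. by have : root_system R m (phi i) by rewrite -phi_range; exists i. Qed.

Lemma phi_surj w s : exists i, phi i = w ∙ root s.
Proof.
have : root_system R m (w ∙ root s) by exists s, w.
by rewrite -phi_range => -[i _ <-]; exists i.
Qed.

Lemma phi_act w i : exists j, phi j = w ∙ phi i.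
Proof. by have [s [v ->]] := rootP i; rewrite -root_actM; exact: phi_surj. Qed.

(* basis vector of the root [v] in the free module over [A] on the roots *)
Definition root_vec (A : pzSemiRingType) v : 'cV[A]_n := \col_i (phi i == v)%:R.

Definition root_perm (A : pzSemiRingType) w : 'M[A]_n :=
  \matrix_(i, j) (phi i == w ∙ phi j)%:R.

Section Coefficients.
Variable A : comUnitRingType.
Local Notation P := (root_perm A).
Local Notation ev := (root_vec A).

Lemma root_vec_phi i : ev (phi i) = delta_mx i 0.
Proof. by apply/matrixP => j k; rewrite ord1 !mxE (inj_eq phi_inj) andbT. Qed.

Lemma root_perm_phi w i : P w *m ev (phi i) = ev (w ∙ phi i).
Proof. by rewrite root_vec_phi -colE; apply/matrixP => j k; rewrite !mxE. Qed.

Lemma root_perm_vec w v : P w *m ev v = ev (w ∙ v).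
Proof.
have [[i <-]|nv] := pselect (exists i, phi i = v); first exact: root_perm_phi.
have notroot u : (forall i, phi i <> u) -> ev u = 0.
  by move=> nu; apply/matrixP => i j; rewrite !mxE; case: eqP => // /nu.
have -> : ev v = 0 by apply: notroot => i iv; apply: nv; exists i.
rewrite mulmx0 notroot // => i iv; apply: nv.
by have [j] := phi_act w^-1%g i; rewrite iv root_actK; exists j.
Qed.

Lemma mx_eq_root_vec (M N : 'M[A]_n) :
  (forall i, M *m ev (phi i) = N *m ev (phi i)) -> M = N.
Proof.
move=> MN; apply/matrixP => i j; have /matrixP/(_ i 0) := MN j.
by rewrite root_vec_phi -!colE !mxE.
Qed.

Lemma root_permM w1 w2 : P (w1 * w2)%g = P w1 *m P w2.
Proof.
apply: mx_eq_root_vec => i; rewrite -mulmxA !root_perm_phi root_actM.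
by have [j <-] := phi_act w2 i; rewrite root_perm_phi.
Qed.

Lemma root_perm1 : P 1%g = 1%:M.
Proof. by apply: mx_eq_root_vec => i; rewrite root_perm_phi root_act1 mul1mx. Qed.

Lemma root_perm_tr w : (P w)^T = P w^-1%g.
Proof.
apply/matrixP => i j; rewrite !mxE.
by rewrite -[in RHS](can_eq (root_actK w)) root_actVK eq_sym.
Qed.

Lemma root_perm_faithful w : P w = 1%:M -> w = 1%g.
Proof.
move=> Pw; apply: (@root_act_faithful R) => s.
have [i] := phi_surj 1%g s; rewrite root_act1 => <-.
have := root_perm_phi w i; rewrite Pw mul1mx => /matrixP/(_ i 0).
by rewrite !mxE eqxx; case: eqP => // _ /eqP; rewrite oner_eq0.
Qed.

Lemma root_perm_unit w : P w \in unitmx.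
Proof.
by have /mulmx1_unit[] : P w *m P w^-1%g = 1%:M by rewrite -root_permM mulgV root_perm1.
Qed.

Definition root_perm_gl w : linear_group A n := Sub (P w) (root_perm_unit w).

Fact root_perm_gl_morphism : group_morphism root_perm_gl.
Proof. by split=> [|w1 w2]; apply: val_inj; [exact: root_perm1|exact: root_permM]. Qed.

Lemma root_perm_gl_inj : injective root_perm_gl.
Proof.
move=> w1 w2 /(congr1 val)/= w12; apply/esym/divg1_eq/root_perm_faithful.
by rewrite root_permM -w12 -root_permM mulgV root_perm1.
Qed.
End Coefficients.

Local Notation E := (euclidean_group R n).
Local Notation P := (root_perm R).
Local Notation ev := (root_vec R).

Lemma rotation_subproof w : (0, P w) \in @motion_set R n.
Proof.
apply/mem_set; rewrite /motion_set /orthogonal_mx /=.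
by rewrite root_perm_tr -root_permM mulVg root_perm1.
Qed.
Definition rotation w : E :=
  exist (fun g => g \in @motion_set R n) _ (rotation_subproof w).

Fact rotation_morphism : group_morphism rotation.
Proof.
split=> [|w1 w2]; apply: val_inj; rewrite /= ?root_perm1 //.
by rewrite root_permM mulmx0 addr0.
Qed.
HB.instance Definition _ := isUMagmaMorphism.Build W E rotation rotation_morphism.

Lemma rotation_translation w x :
  (rotation w * translation x)%g = (translation (P w *m x) * rotation w)%g.
Proof. by apply: val_inj; rewrite /= !mul1mx mulmx1 add0r addr0. Qed.

Definition va_letter_motion (x : (S + S)%type) : E :=
  match x with
  | inl s => (translation (ev (root s)) * rotation (g s))%g
  | inr s => rotation (g s)
  end.
Local Notation f := va_letter_motion.
Local Notation coef := (@dihedral_coef R S m).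

Lemma prodR_sigma_motion s t k : s != t ->
  prodR (f (inl s)) (f (inl t)) k =
  (translation (\sum_(i < k) ev (coef s t i.+1 *: root (if odd k then t else s) +
                                coef s t i *: root (if odd k then s else t)))
   * rotation (prodR (g s) (g t) k))%g.
Proof.
move=> st; have step a b i :
    P (g b) *m ev (coef a b i.+1 *: root a + coef a b i *: root b) = ev (coef a b i.+2 *: root b + coef a b i.+1 *: root a).
  by rewrite root_perm_vec root_act_dihedral.
elim: k => [|k IHk]; first by rewrite big_ord0 translation0 gmulf1 mulg1.
rewrite !prodRSl IHk big_ord_recl.
have -> : (if odd k then f (inl s) else f (inl t)) =
    (translation (ev (root (if odd k then s else t)))
     * rotation (if odd k then g s else g t))%g by case: (odd k).
rewrite translationD /= scale1r scale0r addr0.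
rewrite -!mulgA; congr (_ * _)%g; first by case: (odd k).
rewrite [LHS]mulgA rotation_translation -!mulgA -gmulfM; congr (_ * _)%g.
congr translation; rewrite mulmx_sumr; apply: eq_bigr => i _.
rewrite /bump add1n; case: (odd k) => /=; last by rewrite step.
by rewrite ![coef s t _]dihedral_coefC step.
Qed.

(* In the braid relation of the sigmas, both words list the positive roots of the
   dihedral subsystem, in opposite orders. *)
Lemma va_letter_motion_rel (u v : free_group (S + S)%type) : virtual_artin_rel m u v ->
  free_lift f u = free_lift f v.
Proof.
case=> [s t k st mst|s t k st mst|s|s t k st mst].
- rewrite !prodR_morph /= !free_lift_gen.
  have ts : t != s by rewrite eq_sym.
  rewrite !prodR_sigma_motion // (cox_gen_braid st mst); congr (translation _ * _)%g.
  rewrite [RHS](reindex_inj rev_ord_inj) /=; apply: eq_bigr => i _.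
  rewrite ![coef t s _]dihedral_coefC addrC; congr (ev (_ *: _ + _ *: _)) => /=.
    by rewrite subnSK // (dihedral_coef_sym R st mst) // ltnW.
  by rewrite (dihedral_coef_sym R st mst).
- rewrite !prodR_morph /= !free_lift_gen -!(prodR_morph rotation).
  by rewrite (cox_gen_braid st mst).
- rewrite gmulfXn gmulf1 /= free_lift_gen expg2 /=.
  by rewrite -gmulfM cox_gen_invol gmulf1.
rewrite !gmulfM !prodR_morph /= !free_lift_gen -!(prodR_morph rotation).
have kE : k.-1.+1 = k by rewrite prednK // (ltn_trans _ (cox_offdiag st mst)).
have oddk : odd k = ~~ odd k.-1 by rewrite -[in LHS]kE.
have c0 : coef s t k = 0 by rewrite -(dihedral_coef_sym R st mst) // subnn.
have c1 : coef s t k.-1 = 1.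
  by rewrite -subn1 (dihedral_coef_sym R st mst) // (ltnW (cox_offdiag st mst)).
have -> : f (inl (if odd k then t else s)) = (translation
    (ev (prodR (g s) (g t) k.-1 ∙ root s)) * rotation (g (if odd k then t else s)))%g.
  rewrite prodR_simple_root // kE c0 c1 scale0r add0r scale1r oddk.
  by case: (odd k.-1).
rewrite [LHS]mulgA rotation_translation root_perm_vec -!mulgA; congr (_ * _)%g.
rewrite -!gmulfM; congr rotation.
transitivity (prodR (g s) (g t) k); last by rewrite -kE prodRSl kE oddk; case: (odd k.-1).
by rewrite -(cox_gen_braid st mst) -kE.
Qed.

Definition va_motion : virtual_artin_group m -> E := plift f.

Fact va_motion_morphism : group_morphism va_motion.
Proof. exact: plift_monoid_morphism va_letter_motion_rel. Qed.
HB.instance Definition _ :=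
  isUMagmaMorphism.Build (virtual_artin_group m) E va_motion va_motion_morphism.

Lemma va_motion_sigma s :
  va_motion (va_sigma m s) = (translation (ev (root s)) * rotation (g s))%g.
Proof. exact: (plift_gen va_letter_motion_rel). Qed.

Lemma va_motion_tau s : va_motion (va_tau m s) = rotation (g s).
Proof. exact: (plift_gen va_letter_motion_rel). Qed.

Lemma va_motion_linear x : (val (va_motion x)).2 = P (pi_P x).
Proof.
have PV w : P w^-1%g = (P w)^T by rewrite root_perm_tr.
elim/presented_ind: x => [|[] s x IHx|[] s x IHx].
- by rewrite !gmulf1 /= root_perm1.
- rewrite -/(va_sigma m s) !gmulfM /= IHx root_permM.
  by rewrite va_motion_sigma pi_P_sigma /= mul1mx.
- rewrite -/(va_tau m s) !gmulfM /= IHx root_permM.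
  by rewrite va_motion_tau pi_P_tau.
- rewrite -/(va_sigma m s) !gmulfM !gmulfV /= IHx root_permM.
  by rewrite va_motion_sigma pi_P_sigma /= mul1mx PV.
- rewrite -/(va_tau m s) !gmulfM !gmulfV /= IHx root_permM.
  by rewrite va_motion_tau pi_P_tau /= PV.
Qed.

Lemma va_motion_section w : va_motion (va_section w) = rotation w.
Proof.
elim/cox_ind: w => [|s w IHw]; first by rewrite !gmulf1.
by rewrite !gmulfM /= IHw va_section_gen va_motion_tau.
Qed.

Lemma va_motion_zeta s : va_motion (va_zeta m s) = translation (ev (root s)).
Proof.
rewrite gmulfM /= va_motion_sigma va_motion_tau -mulgA -gmulfM.
by rewrite cox_gen_invol gmulf1 mulg1.
Qed.

Lemma va_motion_pure x : x \in PVA m ->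
  va_motion x = translation (val (va_motion x)).1.
Proof.
rewrite inE => /eqP xP; apply: val_inj.
by rewrite [LHS]surjective_pairing va_motion_linear xP root_perm1.
Qed.

Local Notation Q := (VA_mod_dPVA m).
Local Notation qpi := (quot_pi (derived (PVA m))).

Lemma derived_pi_P x : x \in derived (PVA m) -> pi_P x = 1%g.
Proof.
move: x; apply: derived_ker => x y; rewrite !inE => /eqP -> /eqP ->.
exact: commute_refl.
Qed.

Lemma derived_va_motion x : x \in derived (PVA m) -> va_motion x = 1%g.
Proof.
move: x; apply: derived_ker => x y xP yP /=.
by rewrite /commute (va_motion_pure xP) (va_motion_pure yP) -!translationD addrC.
Qed.

Definition holonomy : Q -> W := quot_lift (@pi_P S m).
Fact holonomy_morphism : group_morphism holonomy.
Proof. exact: quot_lift_morphism derived_pi_P. Qed.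
HB.instance Definition _ := isUMagmaMorphism.Build Q W holonomy holonomy_morphism.
Lemma holonomy_pi x : holonomy (qpi x) = pi_P x.
Proof. exact: (quot_lift_pi derived_pi_P). Qed.

Definition motion : Q -> E := quot_lift va_motion.
Fact motion_morphism : group_morphism motion.
Proof. exact: quot_lift_morphism derived_va_motion. Qed.
HB.instance Definition _ := isUMagmaMorphism.Build Q E motion motion_morphism.
Lemma motion_pi x : motion (qpi x) = va_motion x.
Proof. exact: (quot_lift_pi derived_va_motion). Qed.

Definition holonomy_section (w : W) : Q := qpi (va_section w).
Local Notation sec := holonomy_section.
Fact holonomy_section_morphism : group_morphism sec.
Proof. by split=> [|w1 w2]; rewrite /sec ?gmulf1 // !gmulfM. Qed.
HB.instance Definition _ := isUMagmaMorphism.Build W Q sec holonomy_section_morphism.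

Lemma holonomy_sectionK : cancel sec holonomy.
Proof. by move=> w; rewrite holonomy_pi va_sectionK. Qed.

Lemma motion_section w : motion (sec w) = rotation w.
Proof. by rewrite motion_pi va_motion_section. Qed.

Lemma motion_linear q : (val (motion q)).2 = P (holonomy q).
Proof. by elim/quot_ind: q => x; rewrite motion_pi holonomy_pi va_motion_linear. Qed.

(* PVA / PVA', written additively *)
Definition lattice := {q : Q | holonomy q == 1%g}.
HB.instance Definition _ := SubChoice.on lattice.

Lemma lattice_comm (a b : lattice) : commute (val a) (val b).
Proof.
case: a b => [+ +] [+ +] /=; elim/quot_ind=> x; rewrite holonomy_pi => xP.
elim/quot_ind=> y; rewrite holonomy_pi => yP.
rewrite /commute -!gmulfM; apply/quot_piP.
have -> : ((x * y)^-1 * (y * x) = [~ y, x])%g by rewrite commgEl /conjg invgM !mulgA.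
by apply: mem_generated; exists y, x.
Qed.

Fact lattice_add_subproof (a b : lattice) : holonomy (val a * val b)%g == 1%g.
Proof. by rewrite gmulfM /= (eqP (valP a)) (eqP (valP b)) mulg1. Qed.
Fact lattice_opp_subproof (a : lattice) : holonomy (val a)^-1%g == 1%g.
Proof. by rewrite gmulfV /= (eqP (valP a)) invg1. Qed.
Fact lattice_zero_subproof : holonomy 1%g == 1%g.
Proof. by rewrite gmulf1. Qed.
Definition lattice_add a b : lattice := Sub (val a * val b)%g (lattice_add_subproof a b).
Definition lattice_opp a : lattice := Sub (val a)^-1%g (lattice_opp_subproof a).
Definition lattice_zero : lattice := Sub (1%g : Q) lattice_zero_subproof.

Fact lattice_addA : associative lattice_add.
Proof. by move=> a b c; apply: val_inj; rewrite /= mulgA. Qed.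
Fact lattice_addC : commutative lattice_add.
Proof. by move=> a b; apply: val_inj; exact: lattice_comm. Qed.
Fact lattice_add0 : left_id lattice_zero lattice_add.
Proof. by move=> a; apply: val_inj; rewrite /= mul1g. Qed.
Fact lattice_addN : left_inverse lattice_zero lattice_opp lattice_add.
Proof. by move=> a; apply: val_inj; rewrite /= mulVg. Qed.
HB.instance Definition _ := GRing.isZmodule.Build lattice
  lattice_addA lattice_addC lattice_add0 lattice_addN.

Definition lattice_vec (a : lattice) : 'cV[R]_n := (val (motion (val a))).1.

Lemma motion_lattice a : motion (val a) = translation (lattice_vec a).
Proof.
apply: val_inj; rewrite [LHS]surjective_pairing motion_linear.
by rewrite (eqP (valP a)) root_perm1.
Qed.

Fact lattice_vec_is_additive : additive lattice_vec.
Proof.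
move=> a b; rewrite {1}/lattice_vec [val (a - b)]/= gmulfM gmulfV /= !motion_lattice.
by rewrite /= trmx1 !mul1mx.
Qed.
HB.instance Definition _ :=
  GRing.isAdditive.Build lattice 'cV[R]_n lattice_vec lattice_vec_is_additive.

Fact lattice_conj_subproof w (a : lattice) :
  holonomy (sec w * val a * (sec w)^-1)%g == 1%g.
Proof. by rewrite !gmulfM gmulfV /= (eqP (valP a)) mulg1 mulgV. Qed.
Definition lattice_conj w a : lattice :=
  Sub (sec w * val a * (sec w)^-1)%g (lattice_conj_subproof w a).

Fact lattice_conj_is_additive w : additive (lattice_conj w).
Proof.
by move=> a b; apply: val_inj; rewrite /= !invgM invgK !mulgA mulgVK.
Qed.
HB.instance Definition _ w :=
  GRing.isAdditive.Build lattice lattice (lattice_conj w) (lattice_conj_is_additive w).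

Lemma lattice_conjM w1 w2 a :
  lattice_conj (w1 * w2)%g a = lattice_conj w1 (lattice_conj w2 a).
Proof. by apply: val_inj; rewrite /= gmulfM invgM !mulgA. Qed.

Fact simple_zeta_subproof s : holonomy (qpi (va_zeta m s)) == 1%g.
Proof. by rewrite holonomy_pi; have := va_zeta_pure m s; rewrite inE. Qed.
Definition simple_zeta s : lattice := Sub (qpi (va_zeta m s)) (simple_zeta_subproof s).

Lemma lattice_conj_simple w1 w2 s t : w1 ∙ root s = w2 ∙ root t ->
  lattice_conj w1 (simple_zeta s) = lattice_conj w2 (simple_zeta t).
Proof.
move=> w12; have wst : (w2^-1 * w1)%g ∙ root s = root t.
  by rewrite root_actM w12 root_actK.
rewrite -[w1](mulVKg w2) lattice_conjM; congr lattice_conj; apply: val_inj => /=.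
have -> : (sec (w2^-1 * w1)%g * qpi (va_zeta m s))%g =
    qpi (va_section (w2^-1 * w1)%g * va_zeta m s)%g by rewrite [RHS]gmulfM.
by rewrite (va_section_zeta wst) gmulfM /= mulgK.
Qed.

Lemma zeta_exists i : exists a, exists s w,
  phi i = w ∙ root s /\ a = lattice_conj w (simple_zeta s).
Proof.
have [s [w iE]] := rootP i.
by exists (lattice_conj w (simple_zeta s)), s, w.
Qed.
Definition zeta i : lattice := sval (cid (zeta_exists i)).

Lemma zetaE i s w : phi i = w ∙ root s -> zeta i = lattice_conj w (simple_zeta s).
Proof.
rewrite /zeta; case: cid => _ /= [t [v [-> ->]]]; exact: lattice_conj_simple.
Qed.

Lemma lattice_conj_zeta w i j : phi j = w ∙ phi i -> lattice_conj w (zeta i) = zeta j.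
Proof.
have [s [v iE]] := rootP i.
by rewrite (zetaE iE) iE -root_actM -lattice_conjM => /zetaE.
Qed.

Lemma lattice_vec_zeta i : lattice_vec (zeta i) = delta_mx i 0.
Proof.
have [s [w iE]] := rootP i; rewrite (zetaE iE) -root_vec_phi iE.
have conj : motion (val (lattice_conj w (simple_zeta s))) =
    (rotation w * translation (ev (root s)) / rotation w)%g.
  by rewrite [val _]/= 2!gmulfM gmulfV /= !motion_section motion_pi va_motion_zeta.
by rewrite /lattice_vec conj rotation_translation mulgK /= root_perm_vec.
Qed.

Definition lattice_iota (x : 'cV[int]_n) : lattice := \sum_i zeta i *~ x i 0.

Fact lattice_iota_is_additive : additive lattice_iota.
Proof.
move=> x y; rewrite /lattice_iota -sumrB; apply: eq_bigr => i _.
by rewrite !mxE mulrzBr.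
Qed.
HB.instance Definition _ := GRing.isAdditive.Build 'cV[int]_n lattice
  lattice_iota lattice_iota_is_additive.

Lemma lattice_vec_iota x : lattice_vec (lattice_iota x) = map_mx intr x.
Proof.
rewrite raddf_sum; apply/matrixP => i j; rewrite ord1 summxE !mxE (bigD1 i) //=.
rewrite raddfMz /= lattice_vec_zeta big1 => [|k ki].
  by rewrite addr0 -scaler_int !mxE !eqxx mulr1.
by rewrite raddfMz /= lattice_vec_zeta -scaler_int !mxE eq_sym (negPf ki) mulr0.
Qed.

Lemma lattice_iota_inj : injective lattice_iota.
Proof.
move=> x y /(congr1 lattice_vec); rewrite !lattice_vec_iota => /matrixP xy.
by apply/matrixP => i j; have /eqP := xy i j; rewrite !mxE eqr_int => /eqP.
Qed.

Lemma lattice_iota_delta i : lattice_iota (delta_mx i 0) = zeta i.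
Proof.
rewrite /lattice_iota (bigD1 i) //= big1 => [|k /negPf ki]; rewrite !mxE ?ki //.
by rewrite !eqxx addr0.
Qed.

Lemma lattice_conj_iota w x : exists y, lattice_conj w (lattice_iota x) = lattice_iota y.
Proof.
have [j jE] := choice (phi_act w).
exists (\sum_i delta_mx (j i) 0 *~ x i 0); rewrite !raddf_sum; apply: eq_bigr => i _.
by rewrite !raddfMz /= lattice_iota_delta (lattice_conj_zeta (jE i)).
Qed.

Definition iota (x : 'cV[int]_n) : Q := val (lattice_iota x).

Lemma iotaD : {morph iota : x y / (x + y)%R >-> (x * y)%g}.
Proof. by move=> x y; rewrite /iota raddfD. Qed.

Lemma iota_inj : injective iota.
Proof. exact: inj_comp val_inj lattice_iota_inj. Qed.

Lemma holonomy_iota x : holonomy (iota x) = 1%g.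
Proof. exact: eqP (valP (lattice_iota x)). Qed.

Lemma motion_iota x : motion (iota x) = translation (map_mx intr x).
Proof. by rewrite motion_lattice lattice_vec_iota. Qed.

Lemma section_iota w x : exists y, (sec w * iota x = iota y * sec w)%g.
Proof.
have [y xy] := lattice_conj_iota w x; exists y.
by rewrite /iota -xy /= mulgVK.
Qed.

Lemma iota_section_decomposition q : exists x w, q = (iota x * sec w)%g.
Proof.
elim/quot_ind: q => u.
have decM x w (q : Q) : (exists y (v : W), q = (iota y * sec v)%g) ->
    exists y (v : W), (iota x * sec w * q)%g = (iota y * sec v)%g.
  move=> [y [v ->]]; have [z wy] := section_iota w y.
  exists (x + z), (w * v)%g.
  by rewrite -mulgA (mulgA (sec w)) wy iotaD gmulfM !mulgA.
have zetaP s : exists x, qpi (va_zeta m s) = iota x.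
  have [i iE] := phi_surj 1%g s; exists (delta_mx i 0).
  rewrite /iota lattice_iota_delta (zetaE iE) /=.
  by rewrite gmulf1 mul1g invg1 mulg1.
elim/presented_ind: u => [|[] s u IHu|[] s u IHu]; rewrite ?gmulfM /=.
- by exists 0, 1%g; rewrite !gmulf1 mulg1 /iota raddf0.
- have [x xE] := zetaP s; have -> : qpi (pgen _ (inl s)) = (iota x * sec (g s))%g.
    by rewrite -xE -gmulfM /sec va_section_gen -mulgA va_tau_invol mulg1.
  exact: decM.
- have := decM 0 (g s) _ IHu.
  by rewrite /iota raddf0 /= mul1g /sec va_section_gen.
- have [x xE] := zetaP s; have [y xy] := section_iota (g s) (- x).
  have -> : qpi (pgen _ (inl s))^-1%g = (iota y * sec (g s))%g.
    rewrite -xy; apply/(@mulgI _ (qpi (va_sigma m s))).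
    have xE' : iota x = (qpi (va_sigma m s) * qpi (va_tau m s))%g.
      by rewrite -xE gmulfM.
    rewrite -gmulfM /= mulgV mulgA /sec va_section_gen -xE' -iotaD subrr.
    by rewrite gmulf1 /iota raddf0.
  exact: decM.
- have := decM 0 (g s) _ IHu.
  rewrite /iota raddf0 /= mul1g /sec va_section_gen.
  by rewrite -/(va_tau m s) (mulg1_eq (va_tau_invol m s)).
Qed.

Lemma motion_decomposition x w :
  motion (iota x * sec w)%g = (translation (map_mx intr x) * rotation w)%g.
Proof. by rewrite gmulfM /= motion_iota motion_section. Qed.

Lemma motion_inj : injective motion.
Proof.
apply: gmulf_inj => q; have [x [w ->]] := iota_section_decomposition q.
move=> /(congr1 val); rewrite /= motion_decomposition /= !mul1mx addr0.
move=> [x0 /root_perm_faithful ->]; rewrite gmulf1 mulg1.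
suff -> : x = 0 by rewrite /iota raddf0.
apply/matrixP => i j; have /matrixP/(_ i j)/eqP := x0.
by rewrite !mxE intr_eq0 => /eqP.
Qed.

Lemma short_exact_iota : short_exact iota holonomy.
Proof.
split; [exact: iotaD|exact: iota_inj|exact: holonomy_morphism| |].
  by apply/seteqP; split=> // w _; exists (sec w); rewrite ?holonomy_sectionK.
apply/seteqP; split=> [_ [x _ <-]|q /= q1]; first exact: holonomy_iota.
have [x [w qE]] := iota_section_decomposition q; exists x => //.
move: q1; rewrite qE gmulfM /= holonomy_iota mul1g holonomy_sectionK => ->.
by rewrite gmulf1 mulg1.
Qed.

Lemma map_root_perm w : map_mx intr (root_perm int w) = root_perm R w.
Proof. by apply/matrixP => i j; rewrite !mxE; case: eqP. Qed.

Lemma iota_conj z x :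
  iota (root_perm int (holonomy z) *m x) = (z * iota x * z^-1)%g.
Proof.
apply: motion_inj; rewrite !gmulfM gmulfV /= !motion_iota map_mxM map_root_perm.
have [y [w zE]] := iota_section_decomposition z.
have -> : holonomy z = w.
  by rewrite zE gmulfM /= holonomy_iota mul1g holonomy_sectionK.
rewrite zE motion_decomposition -!mulgA (mulgA (rotation w)) rotation_translation.
rewrite invgM -(mulgA (translation (_ *m _))) mulVKg mulgA -translationD addrC.
by rewrite translationD mulgK.
Qed.

Lemma holonomy_extension_iota : finite_set [set: W] -> holonomy_extension iota holonomy.
Proof.
move=> finW; split=> //; first exact: short_exact_iota.
exists (root_perm_gl int); split; first exact: root_perm_gl_morphism.
  by move=> z x; exact: iota_conj.
exact: root_perm_gl_inj.
Qed.

Definition motion_image : {pred E} := [pred g : E | `[< exists q, motion q = g >]].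

Fact motion_image_mulg_closed : mulg_closed motion_image.
Proof.
move=> _ _ /asboolP[q1 <-] /asboolP[q2 <-]; apply/asboolP.
by exists (q1 * q2)%g; rewrite gmulfM.
Qed.
Fact motion_image_mem1 : 1%g \in motion_image.
Proof. by apply/asboolP; exists 1%g; rewrite gmulf1. Qed.
Fact motion_image_invg_closed : invg_closed motion_image.
Proof.
by move=> _ /asboolP[q <-]; apply/asboolP; exists q^-1%g; rewrite gmulfV.
Qed.
HB.instance Definition _ := isMulClosed.Build E motion_image motion_image_mulg_closed.
HB.instance Definition _ := isMul1Closed.Build E motion_image motion_image_mem1.
HB.instance Definition _ := isInvClosed.Build E motion_image motion_image_invg_closed.

Lemma crystallographic_VA_mod_dPVA : crystallographic R n Q.
Proof.
pose K : groupClosed E := motion_image.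
exists K, motion; split.
- apply: integral_discrete => _ /asboolP[q <-].
  have [x [w ->]] := iota_section_decomposition q; rewrite motion_decomposition.
  rewrite /= !mul1mx addr0.
  by split=> [i|i j]; rewrite !mxE; [exact: intr_int|case: eqP].
- apply: translation_lattice_uniform => x; apply/asboolP.
  by exists (iota x); rewrite motion_iota.
- exact: motion_morphism.
- exact: motion_inj.
apply/seteqP; split=> [_ [q _ <-]|g /asboolP[q <-]]; last by exists q.
by apply/asboolP; exists q.
Qed.
End RootPermutation.

Theorem theorem3p2 (R : realType) (S : finType) (m : coxeter_matrix S) (n : nat)
  (W_spherical : finite_set [set: coxeter_group m])
  (card_Phi : (root_system R m #= `I_n)%card) :
  exists (iota : 'cV[int]_n -> VA_mod_dPVA m)
         (eta : VA_mod_dPVA m -> coxeter_group m),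
    [/\ short_exact iota eta, split_surjection eta,
        crystallographic R n (VA_mod_dPVA m) & holonomy_extension iota eta].
Proof.
have [f [f_fun f_inj f_surj]] : exists f : nat -> 'cV[R]_#|S|,
    set_bij `I_n (root_system R m) f by apply/card_set_bijP; rewrite card_eq_sym.
pose phi (i : 'I_n) := f i.
have phi_inj : injective phi.
  move=> i j ij; apply/val_inj/f_inj => //; rewrite inE; exact: ltn_ord.
have phi_range : range phi = root_system R m.
  apply/seteqP; split=> [_ [i _ <-]|v /f_surj[k kn <-]].
    exact/f_fun/ltn_ord.
  by exists (Ordinal kn).
exists (iota phi_range), (@holonomy S m); split.
- exact: short_exact_iota.
- by exists (@holonomy_section S m);
    [exact: holonomy_section_morphism|exact: holonomy_sectionK].
- exact: (crystallographic_VA_mod_dPVA phi_inj phi_range).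
- exact: holonomy_extension_iota.
Qed.
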